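(* Let $[\cdot,\cdot]:\mathbb{C}[z]\times\mathbb{C}[z]\to\mathbb{C}$ be a Helson form, where $z=(z_1,z_2,\ldots)$. Then: (i) The form $[\cdot,\cdot]$ has finite rank if and only if it can be represented as a finite sum $$[f,g]=\sum_{\ell}\mathbf{D}(\mathbf{c}^{(\ell)})(fg)(\lambda^{(\ell)}),\qquad f,g\in\mathbb{C}[z], \qquad ( * )$$ where for each $\ell$, $\mathbf{D}(\mathbf{c}^{(\ell)})$ is a factorizable differential operator of a finite order and $\lambda^{(\ell)}\in\mathbb{C}^\infty$. (ii) The form $[\cdot,\cdot]$ is bounded and of finite rank if and only if the representation $( * )$ can be chosen such that for all $\ell$ one has $\lambda^{(\ell)}\in\mathbb{D}^\infty\cap\ell^2$ and $\mathbf{c}^{(\ell)}\in\ell^2$.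
   Context: $\mathbb{N}=\{1,2,\dots\}$, $\mathbb{N}_0=\{0,1,2,\dots\}$, $\ell^2=\ell^2(\mathbb{N})$, $\mathbb{D}$ is the open unit disc, $\mathbb{D}^\infty$ and $\mathbb{C}^\infty$ are the countably infinite products. $\mathbb{C}[z]$ is the ring of polynomials in countably many variables $z=(z_1,z_2,\dots)$ (each polynomial involves finitely many variables). For a finitely supported multi-index $\kappa=(\kappa_1,\kappa_2,\dots)$ of non-negative integers, $z^\kappa=\prod_j z_j^{\kappa_j}$. With $p_1<p_2<\cdots$ the primes, each $n\in\mathbb{N}$ is uniquely $n=p^\kappa:=\prod_j p_j^{\kappa_j}$, and we write $\kappa=\kappa(n)$. Helson form: a bilinear form $[\cdot,\cdot]$ on $\mathbb{C}[z]\times\mathbb{C}[z]$ with $[f,g]=[fg,1]$ for all $f,g\in\mathbb{C}[z]$. Equivalently, $[f,g]=\sum_{n,m\ge1}f_ng_m\alpha(nm)$ for $f=\sum_n f_nz^{\kappa(n)}$, $g=\sum_n g_nz^{\kappa(n)}$, where $\alpha(n)=[z^{\kappa(n)},1]$. Finite rank: the subspace $\ker[\cdot,\cdot]=\{f\in\mathbb{C}[z]:[f,g]=0\ \forall g\in\mathbb{C}[z]\}$ has finite codimension in $\mathbb{C}[z]$. Bounded: the Helson matrix $M(\alpha)=\{\alpha(nm)\}_{n,m=1}^\infty$ is a bounded operator on $\ell^2(\mathbb{N})$; equivalently there is $C$ with $|[f,g]|\le C\|f\|\|g\|$ for all $f,g\in\mathbb{C}[z]$, where $\|f\|^2=\sum_n|f_n|^2$.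 Factorizable differential operators: for a sequence $c=\{c(j)\}_{j\in\mathbb{N}}$ of complex numbers, $D(c)f=\sum_{j=1}^\infty c(j)\,\partial_{z_j}f$ for $f\in\mathbb{C}[z]$ (a finite sum for each polynomial $f$). For non-zero sequences $c_1,\dots,c_M$ and $\mathbf{c}=(c_1,\dots,c_M)$, $\mathbf{D}(\mathbf{c})=D(c_1)\cdots D(c_M)$ is called a factorizable differential operator of order $M$. Multiplication by a constant is considered a factorizable differential operator of order $0$. One writes $\mathbf{c}\in\ell^2$ if $c_m\in\ell^2(\mathbb{N})$ for each $m=1,\dots,M$ (no condition when the order is $0$). $\mathbf{D}(\mathbf{c})(fg)(\lambda)$ denotes the value at $\lambda$ of the polynomial $\mathbf{D}(\mathbf{c})(fg)$. *)

(* Defs.v *)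
From HB Require Import structures.
From mathcomp Require Import all_boot all_order all_algebra finmap.
From mathcomp Require Import complex.
From mathcomp Require Import all_classical all_reals all_analysis.
(* The notations of monalg are incompatible with those of the analysis files. *)
From mathcomp Require monalg.
Export -(notations) monalg.

Set Implicit Arguments.
Unset Strict Implicit.
Unset Printing Implicit Defensive.

Import Order.TTheory GRing.Theory Num.Theory.
Import numFieldNormedType.Exports.

Local Open Scope classical_set_scope.
Local Open Scope ring_scope.

(* The complex field is R[i] for an arbitrary model R of the real numbers.
   Variables, primes and sequences are indexed from 0: the variable z_j and
   the j-th prime of the 1-based convention have index j.-1 here. *)

(* C[z]: the monoid algebra of finitely supported multi-indices nat -> nat. *)
Notation cpoly R := (malg (cmonom nat) R[i]).

Definition prime_index (p : nat) : nat := \sum_(q < p) prime q.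

(* The multi-index of n > 0: its entry at prime_index p is logn p n. *)
Definition kappa (n : nat) : cmonom nat :=
  \big[mmul/mone]_(p <- primes n) expcmn (ucm (prime_index p)) (logn p n).

Section Polynomials.
Variable R : realType.
Local Notation C := R[i].
Implicit Types (f : cpoly R) (c lam : nat -> C) (k : cmonom nat).

Definition cmonom_eval lam k : C := \prod_(j <- finsupp k) lam j ^+ k j.

Definition peval lam f : C := mmap idfun (cmonom_eval lam) f.

(* When k j = 0, the exponent is truncated but the coefficient vanishes. *)
Definition pderiv (j : nat) f : cpoly R :=
  \sum_(k <- msupp f) mkmalgU (divcm k (ucm j)) (mcoeff k f *+ k j).

(* The sum has finite support: pderiv j f = 0 unless z_j occurs in f. *)
Definition dirderiv c f : cpoly R :=
  \sum_(j \in [set: nat]) c j *: pderiv j f.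

(* The monomial z^kappa(n). *)
Definition zkappa (n : nat) : cpoly R := mkmalgU (kappa n) 1.

End Polynomials.

Section SquareSummable.
Variable R : realType.
Local Notation C := R[i].
Implicit Type x : nat -> C.

Definition l2norm_sqr x : \bar R :=
  (\sum_(0 <= n <oo) (Normc.normc (x n) ^+ 2)%:E)%E.

Definition in_l2 x : Prop := (l2norm_sqr x < +oo)%E.

Definition in_polydisc x : Prop := forall j, `|x j| < 1.

(* The infinite matrix A acts as a bounded operator on l^2: every row series
   converges on l^2 and |A x| <= K |x|. *)
Definition bounded_matrix (A : nat -> nat -> C) : Prop :=
  exists K : R, forall x, in_l2 x ->
    let Ax n : nat -> C^o := series (fun m => A n m * x m : C^o) in
    (forall n, cvgn (Ax n)) /\
    (l2norm_sqr (fun n => limn (Ax n) : C) <= (K ^+ 2)%:E * l2norm_sqr x)%E.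

End SquareSummable.

Section Forms.
Variable R : realType.
Local Notation C := R[i].
Local Notation P := (cpoly R).
Implicit Type B : {biscalar P}.

Definition Helson_form B : Prop := forall f g : P, B f g = B (f * g) 1.

Definition form_kernel B : set P := [set f | forall g : P, B f g = 0].

(* V / W is spanned by the classes of finitely many vectors. *)
Definition finite_codim (K : fieldType) (V : lmodType K) (W : set V) : Prop :=
  exists (d : nat) (e : 'I_d -> V), forall v : V,
    exists a : 'I_d -> K, W (v - \sum_(i < d) a i *: e i).

Definition finite_rank B : Prop := finite_codim (form_kernel B).

Definition Helson_matrix B (n m : nat) : C := B (zkappa R (n.+1 * m.+1)) 1.

Definition bounded_form B : Prop := bounded_matrix (Helson_matrix B).

End Forms.

Section FactorizableOperators.
Variable R : realType.
Local Notation C := R[i].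

(* FDiff M c is D(c 0) ... D(c M), of order M.+1. *)
Inductive factorizable : Type :=
  | FConst (a : C)
  | FDiff (M : nat) (c : 'I_M.+1 -> nat -> C)
      (c_neq0 : forall m, exists j, c m j != 0).

Definition fapply (D : factorizable) (f : cpoly R) : cpoly R :=
  match D with
  | FConst a => a *: f
  | FDiff M c _ => foldr (fun m h => dirderiv (c m) h) f (enum 'I_M.+1)
  end.

Definition fin_l2 (D : factorizable) : Prop :=
  match D with
  | FConst _ => True
  | FDiff M c _ => forall m, in_l2 (c m)
  end.

Definition represents (B : {biscalar (cpoly R)}) (L : nat)
    (D : 'I_L -> factorizable) (lam : 'I_L -> nat -> C) : Prop :=
  forall f g : cpoly R,
    B f g = \sum_(l < L) peval (lam l) (fapply (D l) (f * g)).

End FactorizableOperators.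

(* Main.v *)
From HB Require Import structures.
Require Import Defs.
From mathcomp Require Import all_boot all_order all_algebra finmap.
From mathcomp Require Import complex.
From mathcomp Require Import all_classical all_reals all_analysis.
From mathcomp Require Import ring lra.

(** Let [phi f = [f, 1]]. The Helson property says [[f, g] = phi (f * g)], so the
    kernel of the form is the radical [I = {f | phi (f * g) = 0 for all g}], an
    ideal of the polynomial ring [P], and finite rank means that [P / I] is a
    finite dimensional commutative algebra.

    From finite rank to the representation. In a finite dimensional quotient the
    commuting multiplications by the variables have a joint eigenvector
    ([joint_eigenvector]): among infinitely many operators one picks eigenvalues
    one at a time, each non-trivial choice lowering the codimension, so only
    finitely many choices are non-trivial. Hence a product of ideals of points lies
    in [I] ([finite_codim_killed]), and since the ideals of distinct points are
    comaximal, [1] is a sum of elements [h] each of which is multiplied into [I] by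
    a power of the ideal of a single point [lam] ([killed_split]). It remains to
    treat [psi f = phi (h * f)]. Modulo its radical every element has dual
    coordinates [v = \sum_i psi (v * h_i) *: e_i] ([dual_basis]); for
    [v = z_j - lam_j] they define sequences [c_i(j) = psi ((z_j - lam_j) * h_i)]
    such that [\sum_i e_i * D(c_i)] is the Euler operator at [lam] modulo the
    radical ([euler]). Iterating Euler's identity expresses [psi] through the
    derivatives [D(c_i1) ... D(c_im)] at [lam]: this is [taylor_formula], a finite
    Taylor expansion in finitely many directions.

    From the representation to finite rank. By the Leibniz rule a derivative of
    [f * g] at a point is a finite sum of products of a derivative of [f] and a
    derivative of [g] at that point ([jets_sum_of_products]), and the common kernel
    of finitely many functionals has finite codimension.

    Boundedness. If the Helson matrix is bounded then its columns are square
    summable, whence [n |-> phi (z^kappa(n) * h)] is square summable for every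
    polynomial [h] ([in_l2_multiple]). A power of the ideal of [lam] killing [h]
    modulo [I] yields a joint eigenvector, that is, a multiple of [phi] proportional
    to the evaluation at [lam]; so [n |-> lam^kappa(n)] is square summable. Along the
    primes this gives [lam \in l^2], along the powers of one prime it gives
    [|lam_j| < 1], and along the primes again the sequences [c_i] are in [l^2]
    ([point_of_radical]).

    Conversely, for [lam] in the polydisc and in [l^2] and directions in [l^2], a
    Cauchy estimate ([dominated_D]) bounds the derivative of [z^kappa] at [lam] by a
    constant times [mu^kappa], where [mu = |lam| + eps * \sum_m |c_m|] still lies in
    the polydisc and in [l^2] for small [eps]; and
    [\sum_n mu^(2 kappa(n)) = \prod_j (1 - mu_j^2)^-1] is finite
    ([multiplicative_sum_le]). So each derivative is a square summable functional,
    and by the Leibniz rule the Helson matrix is a finite sum of tensor products of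
    square summable sequences, a Hilbert-Schmidt matrix. *)

Set Implicit Arguments.
Unset Strict Implicit.
Unset Printing Implicit Defensive.

Import Order.TTheory GRing.Theory Num.Theory.
Import numFieldNormedType.Exports.

Local Open Scope ring_scope.

(** * Linear maps *)

Section LinearMaps.
Variables (K : fieldType) (U V : lmodType K) (f : U -> V).
Hypothesis f_lin : linear f.

Let fL : {linear U -> V} := HB.pack f (GRing.isLinear.Build K U V _ f f_lin).

Lemma linear_0 : f 0 = 0.
Proof. exact: (linear0 fL). Qed.

Lemma linear_D x y : f (x + y) = f x + f y.
Proof. exact: (linearD fL). Qed.

Lemma linear_Z a x : f (a *: x) = a *: f x.
Proof. exact: (linearZ_LR fL). Qed.

End LinearMaps.

Section ScalarMaps.
Variables (K : fieldType) (U : lmodType K) (f : U -> K).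
Hypothesis f_lin : scalar f.

Let fL : {scalar U} := HB.pack f (GRing.isLinear.Build K U K^o _ f f_lin).

Lemma scalar_0 : f 0 = 0.
Proof. exact: (linear0 fL). Qed.

Lemma scalar_D x y : f (x + y) = f x + f y.
Proof. exact: (linearD fL). Qed.

Lemma scalar_B x y : f (x - y) = f x - f y.
Proof. exact: (linearB fL). Qed.

Lemma scalar_Z a x : f (a *: x) = a * f x.
Proof. exact: (linearZ_LR fL). Qed.

Lemma scalar_Sum I (s : seq I) (F : I -> U) :
  f (\sum_(i <- s) F i) = \sum_(i <- s) f (F i).
Proof. exact: (linear_sum fL). Qed.

End ScalarMaps.

(** * Ideals of finite codimension *)

Section FiniteCodimension.
Variables (K : closedFieldType) (A : comAlgType K).
Implicit Types (I J : A -> Prop) (h x : A) (lam mu : nat -> K).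

Definition ideal I : Prop :=
  [/\ I 0, forall x y, I x -> I y -> I (x + y) & forall a x, I x -> I (a * x)].

Definition spans_mod I n (e : 'I_n -> A) : Prop :=
  forall v, exists a : 'I_n -> K, I (v - \sum_i a i *: e i).

Definition codim_le n I : Prop := exists e : 'I_n -> A, spans_mod I e.

Lemma scaleE (c : K) x : c *: x = c%:A * x.
Proof. by rewrite mulr_algl. Qed.

Lemma algM (c d : K) : (c * d)%:A = c%:A * d%:A :> A.
Proof. by rewrite mulr_algl scalerA. Qed.

Lemma idealZ I (c : K) x : ideal I -> I x -> I (c *: x).
Proof. by case=> _ _ IM Ix; rewrite -mulr_algl; apply: IM. Qed.

Lemma idealN I x : ideal I -> I x -> I (- x).
Proof. by move=> idI Ix; rewrite -scaleN1r; apply: idealZ. Qed.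

Lemma ideal_sum I (T : Type) (s : seq T) (F : T -> A) :
  ideal I -> (forall i, I (F i)) -> I (\sum_(i <- s) F i).
Proof. by case=> I0 ID _ IF; elim/big_ind: _. Qed.

Lemma ideal_colon I h : ideal I -> ideal (fun x => I (h * x)).
Proof.
case=> I0 ID IM; split=> [|x y Ix Iy|a x Ix]; first by rewrite mulr0.
  by rewrite mulrDr; apply: ID.
by rewrite mulrCA; apply: IM.
Qed.

Lemma codim_leS I J n : (forall x, I x -> J x) -> codim_le n I -> codim_le n J.
Proof.
by move=> IJ [e eI]; exists e => v; have [a Ia] := eI v; exists a; apply: IJ.
Qed.

(** The coefficient of [e i0] is invertible, so the relation expresses [e i0]
    through the other generators. *)
Lemma codim_drop I J n (e : 'I_n.+1 -> A) (a : 'I_n.+1 -> K) i0 :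
    ideal J -> (forall x, I x -> J x) -> spans_mod I e ->
    a i0 != 0 -> J (\sum_i a i *: e i) -> codim_le n J.
Proof.
move=> idJ IJ eI ai0 Ja; exists (e \o lift i0) => v.
have [b /IJ Jb] := eI v.
pose t := b i0 / a i0.
exists (fun k => b (lift i0 k) - t * a (lift i0 k)).
case: (idJ) => _ JD _; have := JD _ _ Jb (idealZ t idJ Ja).
congr (J _); rewrite (bigD1_ord i0) //= [X in t *: X](bigD1_ord i0) //=.
under [in RHS]eq_bigr do rewrite scalerBl -scalerA.
rewrite sumrB -scaler_sumr scalerDr scalerA divfK //; ring.
Qed.

(** Multiplication by [z] acts on the quotient by a matrix; an eigenvector of the
    matrix is a non-trivial combination killed by [z - lam]. *)
Lemma codim_colon_eigen J n (z : A) :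
    ideal J -> codim_le n.+1 J ->
  exists lam : K, codim_le n (fun x => J ((z - lam%:A) * x)).
Proof.
move=> idJ [e eJ]; case: (idJ) => J0 JD JM.
have [M MJ] := choice (fun i => eJ (z * e i)).
pose g := \matrix_(i, k) M i k.
have /closed_rootP [lam lam_root] : size (char_poly g) != 1%N.
  by rewrite size_char_poly.
rewrite -eigenvalue_root_char in lam_root.
have /eigenvalueP [u ug u0] := lam_root.
have [i0 ui0] : exists i0, u 0 i0 != 0.
  apply/existsP; apply: contraR u0 => /existsPn u0.
  by apply/eqP/rowP => i; rewrite mxE; apply/eqP; rewrite -[_ == _]negbK.
exists lam; apply: (@codim_drop J _ _ e (u 0) i0) => //.
- exact: ideal_colon.
- by move=> x; apply: JM.
have -> : (z - lam%:A) * (\sum_i u 0 i *: e i) =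
          \sum_i u 0 i *: (z * e i - \sum_k M i k *: e k).
  under [RHS]eq_bigr do rewrite scalerBr scaler_sumr.
  rewrite sumrB mulrBl; congr (_ - _).
    by rewrite mulr_sumr; apply: eq_bigr => i _; rewrite scalerAr.
  rewrite exchange_big /= mulr_algl scaler_sumr; apply: eq_bigr => k _.
  rewrite scalerA; have /rowP/(_ k) := ug; rewrite !mxE => <-.
  by rewrite scaler_suml; apply: eq_bigr => i _; rewrite mxE scalerA.
by apply: ideal_sum => // i; apply: idealZ.
Qed.

Variable z : nat -> A.

(** An induction principle for the algebra generated by the [z j]. *)
Definition generates : Prop :=
  forall Q : A -> Prop, Q 1 -> (forall x y, Q x -> Q y -> Q (x + y)) ->
  (forall c x, Q x -> Q (c *: x)) -> (forall j x, Q x -> Q (z j * x)) ->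
  forall x, Q x.

(** Either [h] is already a joint eigenvector modulo I, or some [z j] minus a
    suitable eigenvalue moves [h] to an element outside I whose annihilator is
    strictly larger. *)
Lemma joint_eigenvector I n h :
    ideal I -> codim_le n (fun x => I (h * x)) -> ~ I h ->
  exists (g : A) lam, ~ I g /\ forall j, I ((z j - (lam j)%:A) * g).
Proof.
move=> idI; elim: n h => [|n IHn] h.
  case=> e /(_ 1) [a]; rewrite big_ord0 subr0 mulr1 => Ih /(_ Ih); by [].
move=> Ih NIh.
have [lam Hlam] := choice (fun j => codim_colon_eigen (z j) (ideal_colon h idI) Ih).
have [Hall|] := pselect (forall j, I ((z j - (lam j)%:A) * h)).
  by exists h, lam.
move=> /existsNP [j NIj]; apply: (IHn ((z j - (lam j)%:A) * h)) => //.
by apply: codim_leS (Hlam j) => x; rewrite mulrA [h * _]mulrC.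
Qed.

(** The product of the ideals of the points in the list multiplies [h] into I:
    the ideal of [lam] is generated by the [z j - lam j]. *)
Fixpoint killed I (ls : seq (nat -> K)) h : Prop :=
  if ls is lam :: ls' then forall j, killed I ls' ((z j - (lam j)%:A) * h)
  else I h.

Lemma killed_ideal I ls : ideal I -> ideal (killed I ls).
Proof.
move=> idI; elim: ls => [|l ls [I0 ID IM]] //=; split=> [j|x y Ix Iy j|a x Ix j].
- by rewrite mulr0.
- by rewrite mulrDr; apply: ID.
- by rewrite mulrCA; apply: IM.
Qed.

Lemma killed_cat I ls ls' h :
  killed I (ls ++ ls') h <-> killed (killed I ls') ls h.
Proof. by elim: ls h => //= l ls IH h; split=> H j; apply/IH. Qed.

Lemma killedS I J ls h :
  (forall x, I x -> J x) -> killed I ls h -> killed J ls h.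
Proof.
move=> IJ; elim: ls h => [|l ls IH] h /=; first exact: IJ.
by move=> H j; apply: IH.
Qed.

Hypothesis zgen : generates.

Lemma joint_eigenvalue I h lam : ideal I ->
    (forall j, I ((z j - (lam j)%:A) * h)) ->
  forall f, exists c : K, I (f * h - c *: h).
Proof.
move=> idI; case: (idI) => I0 ID IM Hh.
apply: zgen => [|x y [c Ic] [d Id]|a x [c Ic]|j x [c Ic]].
- by exists 1; rewrite mul1r scale1r subrr.
- by exists (c + d); rewrite mulrDl scalerDl opprD addrACA; apply: ID.
- exists (a * c); rewrite -scalerA -scalerAl -scalerBr; exact: idealZ.
- exists (lam j * c).
  have -> : z j * x * h - (lam j * c) *: h =
      z j * (x * h - c *: h) + c *: ((z j - (lam j)%:A) * h).
    rewrite (scaleE _ h) (scaleE c h) (scaleE c (_ * h)) algM; ring.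
  by apply: ID; [apply: IM|apply: idealZ].
Qed.

(** Induction on the codimension. If [h] is a joint eigenvector modulo I with
    eigenvalues [lam], then I + K h is an ideal of smaller codimension which the
    ideal of [lam] multiplies into I. *)
Lemma finite_codim_killed n I : ideal I -> codim_le n I ->
  exists ls, killed I ls 1.
Proof.
elim: n I => [|n IHn] I idI codI.
  exists [::] => /=; case: codI => e /(_ 1) [a].
  by rewrite big_ord0 subr0.
case: (idI) => I0 ID IM.
have [I1|NI1] := pselect (I 1); first by exists [::].
have codI1 : codim_le n.+1 (fun x => I (1 * x)).
  by apply: codim_leS codI => x; rewrite mul1r.
have [h [lam [NIh Hh]]] := joint_eigenvector idI codI1 NI1.
pose J x := exists c : K, I (x - c *: h).
have idJ : ideal J.
  split=> [|x y [c Ic] [d Id]|a x [c Ic]].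
  - by exists 0; rewrite scale0r subr0.
  - exists (c + d); rewrite scalerDl opprD addrACA; exact: ID.
  - have [b Ib] := joint_eigenvalue idI Hh a.
    exists (c * b); have -> : a * x - (c * b) *: h =
        a * (x - c *: h) + c *: (a * h - b *: h).
      by rewrite (scaleE _ h) (scaleE c h) (scaleE c (_ - _)) (scaleE b h) algM; ring.
    by apply: ID; [apply: IM|apply: idealZ].
have IJ x : I x -> J x by move=> Ix; exists 0; rewrite scale0r subr0.
case: codI => e eI.
have [a Ia] := eI h.
have [i0 ai0] : exists i0, a i0 != 0.
  apply: contrapT => /forallNP Ha; apply: NIh.
  rewrite big1 ?subr0 // in Ia => i _.
  by have /negP := Ha i; rewrite negbK => /eqP ->; rewrite scale0r.
have codJ : codim_le n J.
  apply: (codim_drop idJ IJ eI ai0).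
  exists 1; rewrite scale1r -opprB; exact: idealN.
have [ls Hls] := IHn J idJ codJ.
exists (ls ++ [:: lam]); apply/killed_cat; apply: killedS Hls => x [c Ic] j /=.
rewrite -[x](subrK (c *: h)) mulrDr; apply: ID; first exact: IM.
by rewrite -scalerAr; apply: idealZ.
Qed.

Lemma killed_nseq I n mu ls h j : killed I (nseq n mu ++ ls) h ->
  killed I ls ((z j - (mu j)%:A) ^+ n * h).
Proof.
elim: n h => [|n IHn] h /=; first by rewrite expr0 mul1r.
by move=> /(_ j) /IHn; rewrite exprSr mulrA.
Qed.

Lemma killed_remove I s1 nu s2 h j : killed I (s1 ++ nu :: s2) h ->
  killed I (s1 ++ s2) ((z j - (nu j)%:A) * h).
Proof.
elim: s1 h => [|l s1 IHs] h /=; first exact.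
by move=> H i; rewrite mulrCA; apply: IHs.
Qed.

(** A primary decomposition. If the points nu and rho differ at j, then a power of
    [z j - nu j] and [z j - rho j] are comaximal, so that [h] is a sum of two
    elements, each killed by a shorter list. *)
Lemma killed_split I (Q : A -> Prop) : ideal I ->
    (forall x y, Q x -> Q y -> Q (x + y)) ->
    (forall N mu h, killed I (nseq N mu) h -> Q h) ->
  forall ls h, killed I ls h -> Q h.
Proof.
move=> idI QD Qloc ls; have [n] := ubnP (size ls).
elim: n ls => // n IHn [|nu ls] szls h; first exact: (Qloc 0 (fun=> 0)).
have : (size ls < n)%N by [].
(* A first block of [a.+1] copies of nu is kept apart while the rest is scanned. *)
rewrite -[nu :: ls]/(nseq 1 nu ++ ls) -(addn0 (size ls)); move: 0%N => a.
elim: ls a h {szls} => [|rho ls IHls] a h szls.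
  by rewrite cats0; apply: Qloc.
have [->|/eqP nu_rho] := pselect (rho = nu).
  have -> : nseq a.+1 nu ++ nu :: ls = nseq a.+2 nu ++ ls.
    by rewrite -[nu :: ls]/(nseq 1 nu ++ ls) catA -nseqD addn1.
  by apply: IHls; rewrite addnS.
have [j muj] : exists j, nu j != rho j.
  apply: contrapT => /forallNP H; move/eqP: nu_rho; apply.
  by apply/funext => j; have /negP := H j; rewrite negbK => /eqP.
move=> H.
pose d := rho j - nu j; have d0 : d ^+ a.+1 != 0.
  by rewrite expf_neq0 // subr_eq0 eq_sym.
set x := z j - (nu j)%:A; set y := z j - (rho j)%:A.
have xy : x - y = d%:A by rewrite /x /y scalerBl; ring.
have [q Hq] : exists q, x ^+ a.+1 - (d ^+ a.+1)%:A = y * q.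
  have -> : (d ^+ a.+1)%:A = d%:A ^+ a.+1 :> A by rewrite -!in_algE rmorphXn.
  by rewrite subrXX -xy opprB addrCA subrr addr0; eexists.
have -> : h = (d ^- a.+1)%:A * (x ^+ a.+1 * h) + - (d ^- a.+1)%:A * q * (y * h).
  have DD : (d ^- a.+1)%:A * (d ^+ a.+1)%:A = 1 :> A.
    by rewrite -algM mulVf ?scale1r.
  rewrite -[x ^+ _](subrK (d ^+ a.+1)%:A) Hq; move: DD.
  set D := (d ^+ a.+1)%:A; set D' := (d ^- a.+1)%:A => DD.
  by transitivity (D' * D * h); [rewrite DD mul1r | ring].
apply: QD.
  have [_ _ kM] := killed_ideal (rho :: ls) idI.
  apply: (IHn (rho :: ls)).
    by apply: leq_ltn_trans szls; rewrite leq_addr.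
  by apply: kM; apply: killed_nseq H.
have [_ _ kM] := killed_ideal (nseq a.+1 nu ++ ls) idI.
apply: (IHls a); first by apply: ltnW; rewrite -addSn.
by apply: kM; apply: killed_remove H.
Qed.

(** Multiply by the [z j - lam j] for as long as the product stays outside I. *)
Lemma killed_eigenvector I N lam h : ideal I -> killed I (nseq N lam) h ->
  ~ I h -> exists g, ~ I (g * h) /\ forall j, I ((z j - (lam j)%:A) * (g * h)).
Proof.
move=> idI; elim: N h => [|N IHN] h //= Hh NIh.
have [Hall|/existsNP [j NIj]] :=
  pselect (forall j, I ((z j - (lam j)%:A) * h)).
  by exists 1; rewrite mul1r.
have [g [NIg Hg]] := IHN _ (Hh j) NIj.
by exists (g * (z j - (lam j)%:A)); rewrite -mulrA.
Qed.

Section DualBasis.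
Variable phi : A -> K.
Hypothesis phi_lin : scalar phi.

Definition radical f : Prop := forall g, phi (f * g) = 0.

(** The Gram matrix G of a spanning family may be singular, but the vector of
    pairings of [v] with the family lies in its row space, where the partial
    inverse of G is a true inverse. *)
Lemma dual_basis n (e : 'I_n -> A) : spans_mod radical e ->
  exists h : 'I_n -> A, forall v, radical (v - \sum_i phi (v * h i) *: e i).
Proof.
move=> eI.
have phiB := scalar_B phi_lin; have phiZ := scalar_Z phi_lin.
have phi_sum := scalar_Sum phi_lin.
pose G := \matrix_(a, b) phi (e a * e b).
exists (fun a => \sum_b pinvmx G b a *: e b) => v.
have [x xI] := eI v.
pose y := \row_b phi (v * e b).
have yG : y = (\row_a x a) *m G.
  apply/rowP => b; rewrite !mxE; have := xI (e b).
  rewrite mulrBl phiB => /subr0_eq ->.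
  rewrite mulr_suml phi_sum; apply: eq_bigr => a _.
  by rewrite -scalerAl phiZ !mxE.
have x'G : y *m pinvmx G *m G = y by rewrite mulmxKpV // yG submxMl.
have x'E a : phi (v * (\sum_b pinvmx G b a *: e b)) = (y *m pinvmx G) 0 a.
  rewrite mulr_sumr phi_sum mxE; apply: eq_bigr => b _.
  by rewrite -scalerAr phiZ !mxE mulrC.
under eq_bigr do rewrite x'E.
set u := v - _.
have ue b : phi (u * e b) = 0.
  rewrite mulrBl phiB.
  have /rowP/(_ b) := x'G; rewrite [X in _ = X -> _]mxE => <-.
  rewrite mulr_suml phi_sum mxE; apply/eqP.
  rewrite subr_eq0; apply/eqP/eq_bigr => a _.
  by rewrite -scalerAl phiZ [G a b]mxE.
move=> g; have [c cI] := eI g; have := cI u.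
rewrite mulrBl phiB => /subr0_eq; rewrite mulrC => ->.
rewrite mulr_suml phi_sum big1 // => b _.
by rewrite -scalerAl phiZ [e b * u]mulrC ue mulr0.
Qed.

End DualBasis.

End FiniteCodimension.

(** * Jets: derivatives evaluated at a point *)

(** The arguments of this part only use the following properties of polynomials,
    of the directional derivatives [D c] and of the evaluations [ev lam]. *)

Section Representation.
Variables (K : numClosedFieldType) (A : comAlgType K) (z : nat -> A).
Variables (D : (nat -> K) -> A -> A) (ev : (nat -> K) -> A -> K).
Hypothesis zgen : generates z.
Hypothesis D_lin : forall c, linear (D c).
Hypothesis D1 : forall c, D c 1 = 0.
Hypothesis DzM : forall c j f, D c (z j * f) = c j *: f + z j * D c f.
Hypothesis ev_lin : forall lam, scalar (ev lam).
Hypothesis ev1 : forall lam, ev lam 1 = 1.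
Hypothesis evzM : forall lam j f, ev lam (z j * f) = lam j * ev lam f.
Implicit Types (f g h : A) (c lam : nat -> K) (Phi Psi phi : A -> K).

(** The functionals [f |-> D(c_1) ... D(c_M) f (lam)] with all [c_m] in X. *)
Inductive jet (X : (nat -> K) -> Prop) lam : (A -> K) -> Prop :=
| jet_ev : jet X lam (ev lam)
| jet_D c Phi : X c -> jet X lam Phi -> jet X lam (fun f => Phi (D c f)).

(** Finite linear combinations of jets in directions from X at points from Y. *)
Inductive jets (Y X : (nat -> K) -> Prop) : (A -> K) -> Prop :=
| jets0 : jets Y X (fun=> 0)
| jetsS a lam Phi Psi : Y lam -> jet X lam Phi -> jets Y X Psi ->
    jets Y X (fun f => a * Phi f + Psi f).

Section JetSums.
Variables Y X : (nat -> K) -> Prop.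

Lemma jetsD Phi Psi : jets Y X Phi -> jets Y X Psi ->
  jets Y X (fun f => Phi f + Psi f).
Proof.
move=> jPhi jPsi; elim: jPhi => [|a lam Th Om Yl jTh _ IH].
  by under eq_fun do rewrite add0r; apply: jPsi.
by under eq_fun do rewrite -addrA; exact: (jetsS a Yl jTh IH).
Qed.

Lemma jetsZ b Phi : jets Y X Phi -> jets Y X (fun f => b * Phi f).
Proof.
elim=> [|a lam Th Om Yl jTh _ IH].
  by under eq_fun do rewrite mulr0; apply: jets0.
by under eq_fun do rewrite mulrDr mulrA; exact: (jetsS (b * a) Yl jTh IH).
Qed.

Lemma jets_D c Phi : X c -> jets Y X Phi -> jets Y X (fun f => Phi (D c f)).
Proof.
move=> Xc; elim=> [|a lam Th Om Yl jTh _ IH]; first exact: jets0.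
exact: (jetsS (Phi := fun f => Th (D c f)) a Yl (jet_D Xc jTh) IH).
Qed.

Lemma jets_sum n (F : 'I_n -> A -> K) : (forall i, jets Y X (F i)) ->
  jets Y X (fun f => \sum_i F i f).
Proof.
elim: n F => [|n IHn] F HF.
  by under eq_fun do rewrite big_ord0; apply: jets0.
under eq_fun do rewrite big_ord_recl.
by apply: jetsD => //; apply: IHn.
Qed.

Lemma jets_jet lam Phi : Y lam -> jet X lam Phi -> jets Y X Phi.
Proof.
move=> Yl jPhi; have := jetsS 1 Yl jPhi (jets0 Y X).
by under eq_fun do rewrite mul1r addr0.
Qed.

End JetSums.

Lemma jet_scalar X lam Phi : jet X lam Phi -> scalar Phi.
Proof.
elim=> [|c Psi Xc _ IH]; first exact: ev_lin.
by move=> a f g; rewrite D_lin IH.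
Qed.

Lemma radical_ideal phi : scalar phi -> ideal (radical phi).
Proof.
move=> phi_lin; split=> [g|x y Ix Iy g|a x Ix g].
- by rewrite mul0r (scalar_0 phi_lin).
- by rewrite mulrDl (scalar_D phi_lin) Ix Iy addr0.
- by rewrite mulrC mulrA mulrC [g * a]mulrC Ix.
Qed.

Lemma killed_ideal_mem (I : A -> Prop) ls h : ideal I -> I h -> killed z I ls h.
Proof.
move=> idI; elim: ls h => [|l ls IH] h Ih //= j; apply: IH.
by case: idI => _ _; apply.
Qed.

Section LocalTaylor.
Variables (lam : nat -> K).
Local Notation y j := (z j - (lam j)%:A).

(** The polynomials homogeneous of a given degree in the [z j - lam j]. *)
Inductive homog : nat -> A -> Prop :=
| homog1 : homog 0 1
| homog0 n : homog n 0
| homogD n f g : homog n f -> homog n g -> homog n (f + g)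
| homogZ n a f : homog n f -> homog n (a *: f)
| homogM n j f : homog n f -> homog n.+1 (y j * f).

(** Each [z j] is [z j - lam j] plus a constant; the induction on [f] is on all [Q]
    at once, passing from [Q] to its inverse image under multiplication by [z j]. *)
Lemma homog_span (Q : A -> Prop) : (forall f g, Q f -> Q g -> Q (f + g)) ->
  (forall a f, Q f -> Q (a *: f)) -> (forall n f, homog n f -> Q f) ->
  forall f, Q f.
Proof.
move=> QD QZ QH f; elim/zgen: f Q QD QZ QH => [|f g IHf IHg|a f IHf|j f IHf] Q QD QZ QH.
- exact: QH homog1.
- exact: (QD _ _ (IHf Q QD QZ QH) (IHg Q QD QZ QH)).
- exact: (QZ _ _ (IHf Q QD QZ QH)).
- apply: (IHf (fun f => Q (z j * f))) => [g h Qg Qh|a g Qg|n g Hg].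
  + by rewrite mulrDr; apply: (QD).
  + by rewrite -scalerAr; apply: QZ.
  + rewrite -[z j](subrK (lam j)%:A) mulrDl mulr_algl; apply: QD.
      by apply: QH (homogM j Hg).
    exact: (QZ _ _ (QH _ _ Hg)).
Qed.

Lemma D_yM c j f : D c (y j * f) = c j *: f + y j * D c f.
Proof.
have DE a g h : D c (g - a *: h) = D c g - a *: D c h.
  by rewrite addrC -scaleNr D_lin addrC scaleNr.
by rewrite !mulrBl !mulr_algl DE DzM addrA.
Qed.

Lemma ev_yM j f : ev lam (y j * f) = 0.
Proof.
by rewrite mulrBl mulr_algl (scalar_B (@ev_lin _)) evzM (scalar_Z (@ev_lin _)) subrr.
Qed.

Lemma homog_D c n f : homog n f ->
  if n is m.+1 then homog m (D c f) else D c f = 0.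
Proof.
have D0 : D c 0 = 0 by exact: (linear_0 (D_lin c)).
elim=> [|n0|n0 f0 g _ IHf _ IHg|n0 a f0 _ IHf|n0 j f0 Hf IHf].
- exact: D1.
- by case: n0 => [|n0]; rewrite D0 //; apply: homog0.
- rewrite (linear_D (D_lin c)).
  by case: n0 IHf IHg => [-> ->|m IHf IHg]; [rewrite addr0|apply: homogD].
- rewrite (linear_Z (D_lin c)).
  by case: n0 IHf => [->|m IHf]; [rewrite scaler0|apply: homogZ].
- rewrite D_yM; case: n0 Hf IHf => [|m] Hf IHf.
    by rewrite IHf mulr0 addr0; apply: homogZ.
  by apply: homogD; [apply: homogZ|apply: homogM].
Qed.

Lemma homog_ev n f : homog n f -> if n is m.+1 then ev lam f = 0 else f = (ev lam f)%:A.
Proof.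
elim=> [|n0|n0 f0 g _ IHf _ IHg|n0 a f0 _ IHf|n0 j f0 Hf IHf].
- by rewrite ev1 scale1r.
- by case: n0; rewrite (scalar_0 (@ev_lin _)) ?scale0r.
- case: n0 IHf IHg => [-> ->|m IHf IHg]; rewrite (scalar_D (@ev_lin _)).
    by rewrite !(scalar_Z (@ev_lin _)) ev1 !mulr1 scalerDl.
  by rewrite IHf IHg addr0.
- case: n0 IHf => [{1}->|m IHf]; rewrite (scalar_Z (@ev_lin _)).
    by rewrite scalerA.
  by rewrite IHf mulr0.
- exact: ev_yM.
Qed.

Lemma homog_killed (I : A -> Prop) n f h : homog n f ->
  ideal I -> killed z I (nseq n lam) h -> I (f * h).
Proof.
move=> Hf idI; case: (idI) => I0 ID IM.
elim: Hf h => [|n0|n0 f0 g _ IHf _ IHg|n0 a f0 _ IHf|n0 j f0 Hf IHf] h kh.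
- by rewrite mul1r.
- by rewrite mul0r.
- by rewrite mulrDl; apply: ID; [apply: IHf|apply: IHg].
- by rewrite -scalerAl; apply: idealZ => //; apply: IHf.
- by rewrite mulrAC mulrC; apply: IHf; apply: kh.
Qed.

Variables (phi : A -> K) (n : nat) (e h : 'I_n -> A).
Hypothesis phi_lin : scalar phi.
Hypothesis dual_eh : forall v, radical phi (v - \sum_i phi (v * h i) *: e i).

Let c i j : K := phi (y j * h i).

(** Modulo the radical [\sum_i c i j *: e i] is [z j - lam j], so that
    [\sum_i e i * D (c i)] acts as [\sum_j (z j - lam j) * d/dz_j], the Euler
    operator centred at [lam]. *)
Lemma euler m f : homog m f ->
  radical phi (\sum_i e i * D (c i) f - m%:R *: f).
Proof.
have idI := radical_ideal phi_lin; case: (idI) => I0 ID IM.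
have D0 i : D (c i) 0 = 0 by apply: (homog_D (c i) (homog0 0)).
elim=> [|n0|n0 f0 g _ IHf _ IHg|n0 a f0 _ IHf|n0 j f0 Hf IHf].
- by rewrite scale0r subr0 big1 // => i _; rewrite D1 mulr0.
- by rewrite scaler0 subr0 big1 // => i _; rewrite D0 mulr0.
- have := ID _ _ IHf IHg; congr (radical phi _).
  rewrite scalerDr opprD addrACA -big_split; congr (_ + _).
  by apply: eq_bigr => i _; rewrite (linear_D (D_lin (c i))) mulrDr.
- have := idealZ a idI IHf; congr (radical phi _).
  rewrite scalerBr !scalerA mulrC scaler_sumr; congr (_ - _).
  by apply: eq_bigr => i _; rewrite (linear_Z (D_lin _)) scalerAr.
- have := ID _ _ (IM (- f0) _ (dual_eh (y j))) (IM (y j) _ IHf).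
  congr (radical phi _).
  under [in RHS]eq_bigr do rewrite D_yM mulrDr -scalerAr.
  rewrite big_split /= mulrBr mulr_sumr.
  rewrite [y j * (_ - _)]mulrBr mulr_sumr.
  have -> : \sum_i - f0 * (phi (y j * h i) *: e i) = - \sum_i c i j *: (e i * f0).
    rewrite -sumrN; apply: eq_bigr => i _.
    by rewrite mulNr -scalerAr [f0 * _]mulrC.
  have -> : \sum_i y j * (e i * D (c i) f0) = \sum_i e i * (y j * D (c i) f0).
    by apply: eq_bigr => i _; rewrite mulrCA.
  rewrite -natr1 scalerDl scale1r -scalerAr; ring.
Qed.

(** The sum over [i_1, ..., i_m] of
    [phi (g * e i_1 * ... * e i_m) * (D (c i_m) ... D (c i_1) f) (lam)]. *)
Fixpoint taylor m g f : K :=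
  if m is m'.+1 then \sum_i taylor m' (g * e i) (D (c i) f)
  else phi g * ev lam f.

Lemma taylor_scalar m g : scalar (taylor m g).
Proof.
elim: m g => [|m IHm] g a f f' /=.
  by rewrite (scalar_D (@ev_lin _)) (scalar_Z (@ev_lin _)); ring.
rewrite mulr_sumr -big_split; apply: eq_bigr => i _.
by rewrite D_lin IHm.
Qed.

(** Euler's identity applied m times. *)
Lemma taylor_homog m f g : homog m f -> taylor m g f = m`!%:R * phi (g * f).
Proof.
elim: m f g => [|m IHm] f g Hf /=.
  rewrite {2}(homog_ev Hf) mulrC mul1r -scalerAr mulr1 (scalar_Z phi_lin).
  by rewrite mulrC mulrC.
under eq_bigr => i _ do rewrite (IHm _ _ (homog_D (c i) Hf)).
rewrite -mulr_sumr factS natrM -mulrA [in RHS]mulrCA; congr (_ * _).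
rewrite -(scalar_Z phi_lin) -(scalar_Sum phi_lin).
under eq_bigr do rewrite -mulrA; rewrite -mulr_sumr scalerAr.
apply/eqP; rewrite -subr_eq0 -(scalar_B phi_lin) -mulrBr mulrC.
by rewrite (euler Hf).
Qed.

(** Too many derivatives annihilate [f]; too few leave a positive degree, which
    vanishes at [lam]. *)
Lemma taylor_other m m' f g : homog m' f -> m != m' -> taylor m g f = 0.
Proof.
elim: m m' f g => [|m IHm] [|m'] f g Hf //=.
- by rewrite (homog_ev Hf) mulr0.
- move=> _; apply: big1 => i _; rewrite (homog_D (c i) Hf).
  by apply: (IHm m.+1); [apply: homog0|rewrite ltn_eqF].
- rewrite eqSS => mm'; apply: big1 => i _.
  exact: IHm (homog_D (c i) Hf) mm'.
Qed.

Lemma taylor_formula N : killed z (radical phi) (nseq N lam) 1 ->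
  forall f, phi f = \sum_(m < N) (m`!%:R)^-1 * taylor m 1 f.
Proof.
move=> kN; have idI := radical_ideal phi_lin.
apply: homog_span => [f g Hf Hg|a f Hf|m f Hf].
- rewrite (scalar_D phi_lin) Hf Hg -big_split; apply: eq_bigr => m _ /=.
  by rewrite (scalar_D (taylor_scalar _ _)) mulrDr.
- rewrite (scalar_Z phi_lin) Hf mulr_sumr; apply: eq_bigr => m _.
  by rewrite (scalar_Z (taylor_scalar _ _)) mulrCA.
have [mN|Nm] := ltnP m N.
  rewrite (bigD1 (Ordinal mN)) //= big1 => [|i]; last first.
    rewrite -val_eqE /= => im.
    by rewrite (taylor_other _ Hf im) mulr0.
  rewrite addr0 (taylor_homog _ Hf) mul1r mulKf //.
rewrite big1 => [|i _]; last first.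
  by rewrite (taylor_other _ Hf) ?mulr0 // ltn_eqF // (leq_trans _ Nm).
have km : killed z (radical phi) (nseq m lam) 1.
  rewrite -(subnK Nm) nseqD; apply/killed_cat.
  by apply: killed_ideal_mem; first exact: killed_ideal.
by have := homog_killed Hf idI km 1; rewrite !mulr1.
Qed.

Lemma jets_taylor (Y X : (nat -> K) -> Prop) m g : Y lam -> (forall i, X (c i)) ->
  jets Y X (taylor m g).
Proof.
move=> Yl Xc; elim: m g => [|m IHm] g.
  have -> : taylor 0 g = fun f => phi g * ev lam f by [].
  exact/jetsZ/(jets_jet Yl)/jet_ev.
have -> : taylor m.+1 g = fun f => \sum_i taylor m (g * e i) (D (c i) f) by [].
apply: jets_sum => i; exact: (jets_D (Xc i) (IHm (g * e i))).
Qed.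

End LocalTaylor.

(** The hypothesis on Y and X concerns every point lam that occurs in the
    decomposition of the radical, and every direction [c i] of the expansion at
    lam. *)
Theorem jets_of_finite_codim (Y X : (nat -> K) -> Prop) d phi : scalar phi ->
    codim_le d (radical phi) ->
    (forall N lam h, killed z (radical phi) (nseq N lam) h -> ~ radical phi h ->
       Y lam /\ forall g, X (fun j => phi ((z j - (lam j)%:A) * (g * h)))) ->
  jets Y X phi.
Proof.
move=> phi_lin codI YX; have idI := radical_ideal phi_lin.
have [ls kls] := finite_codim_killed zgen idI codI.
suff : jets Y X (fun f => phi (1 * f)) by under eq_fun do rewrite mul1r.
apply: (killed_split (Q := fun h => jets Y X (fun f => phi (h * f)))) kls => //.
  move=> x y jx jy; under eq_fun do rewrite mulrDl (scalar_D phi_lin).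
  exact: jetsD.
move=> N lam h kh.
have [Ih|NIh] := pselect (radical phi h).
  by under eq_fun do rewrite Ih; apply: jets0.
have [Yl Xl] := YX N lam h kh NIh.
pose psi f := phi (h * f).
have psi_lin : scalar psi.
  by move=> a f g; rewrite /psi mulrDr -scalerAr (scalar_D phi_lin) (scalar_Z phi_lin).
have psiE x : radical psi x <-> radical phi (x * h).
  by split=> H g; [rewrite mulrAC mulrC|rewrite /psi mulrA [h * x]mulrC]; apply: H.
have [n [e eI]] : exists n, codim_le n (radical psi).
  exists d; apply: codim_leS codI => x Ix g.
  by rewrite /psi mulrCA; apply: Ix.
have [k dual] := dual_basis psi_lin eI.
have kpsi : killed z (radical psi) (nseq N lam) 1.
  have : forall ls x, killed z (radical phi) ls (x * h) -> killed z (radical psi) ls x.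
    elim=> [|l ls' IH] x /=; first by move/psiE.
    by move=> H j; apply: IH; rewrite -mulrA.
  by apply; rewrite mul1r.
have -> : (fun f => phi (h * f)) = psi by [].
rewrite (funext (taylor_formula psi_lin dual kpsi)).
apply: jets_sum => m; apply: jetsZ; apply: jets_taylor => // i.
have := Xl (k i); congr X; apply/funext => j.
by rewrite /psi; congr phi; ring.
Qed.

Section Separation.
Variable Q : (A -> K) -> Prop.

Inductive sum_of_products : (A -> A -> K) -> Prop :=
| products_nil : sum_of_products (fun _ _ => 0)
| products_cons a Phi Psi T : Q Phi -> Q Psi -> sum_of_products T ->
    sum_of_products (fun f g => a * (Phi f * Psi g) + T f g).

Lemma sum_of_productsD T S : sum_of_products T -> sum_of_products S ->
  sum_of_products (fun f g => T f g + S f g).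
Proof.
move=> sT sS; elim: sT => [|a Phi Psi T' QPhi QPsi _ IH].
  by have -> : (fun f g => 0 + S f g) = S by do 2 apply/funext => ?; rewrite add0r.
have -> : (fun f g => a * (Phi f * Psi g) + T' f g + S f g)
    = (fun f g => a * (Phi f * Psi g) + (T' f g + S f g)).
  by do 2 apply/funext => ?; rewrite addrA.
exact: products_cons.
Qed.

Lemma sum_of_productsZ b T : sum_of_products T -> sum_of_products (fun f g => b * T f g).
Proof.
elim=> [|a Phi Psi T' QPhi QPsi _ IH].
  have -> : (fun _ _ : A => b * 0) = (fun _ _ => 0 : K).
    by do 2 apply/funext => ?; rewrite mulr0.
  exact: products_nil.
have -> : (fun f g => b * (a * (Phi f * Psi g) + T' f g))
    = (fun f g => (b * a) * (Phi f * Psi g) + b * T' f g).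
  by do 2 apply/funext => ?; rewrite mulrDr mulrA.
exact: products_cons.
Qed.

(** Intersecting with the kernel of one more left factor raises the codimension by
    at most one. *)
Lemma sum_of_products_codim T : (forall Phi, Q Phi -> scalar Phi) -> sum_of_products T ->
  exists d, codim_le d (fun f => forall g, T f g = 0).
Proof.
move=> Qlin sT.
suff [d [W [[W0 WD WZ] codW WT]]] : exists d (W : A -> Prop),
    [/\ [/\ W 0, forall x y, W x -> W y -> W (x + y) & forall b x, W x -> W (b *: x)],
     codim_le d W & forall f, W f -> forall g, T f g = 0].
  by exists d; apply: codim_leS codW.
elim: sT => [|a Phi Psi T' QPhi QPsi _ [d [W [[W0 WD WZ] codW WT]]]].
  exists 0%N, (fun=> True); split=> //.
  by exists (fun=> 0) => v; exists (fun=> 0).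
have Phi_lin := Qlin _ QPhi.
have [[w [Ww Phiw]]|/forallNP PhiW] := pselect (exists w, W w /\ Phi w <> 0); last first.
  exists d, W; split=> // f Wf g; rewrite WT // addr0.
  by have [->|Phif] := eqVneq (Phi f) 0; [rewrite mul0r mulr0
                                         |case: (PhiW f); split=> //; apply/eqP].
exists d.+1, (fun f => W f /\ Phi f = 0); split.
- split=> [|x y [Wx Px] [Wy Py]|b x [Wx Px]].
  + by split; rewrite ?(scalar_0 Phi_lin).
  + by split; [apply: WD|rewrite (scalar_D Phi_lin) Px Py addr0].
  + by split; [apply: WZ|rewrite (scalar_Z Phi_lin) Px mulr0].
- case: codW => e eW.
  exists (fun i => if unlift ord0 i is Some j then e j else w) => v.
  have [b Wb] := eW v; pose u := v - \sum_i b i *: e i; pose t := Phi u / Phi w.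
  exists (fun i => if unlift ord0 i is Some j then b j else t).
  rewrite big_ord_recl unlift_none.
  under eq_bigr do rewrite liftK.
  have -> : v - (t *: w + \sum_(i < d) b i *: e i) = u + (- t) *: w.
    by rewrite /u scaleNr opprD addrCA addrC.
  split; first by apply: WD => //; apply: WZ.
  rewrite (scalar_D Phi_lin) (scalar_Z Phi_lin) mulNr divfK ?subrr //.
  exact/eqP.
- by move=> f [Wf Phif] g; rewrite WT // addr0 Phif mul0r mulr0.
Qed.

End Separation.

Lemma ev_mult lam f g : ev lam (f * g) = ev lam f * ev lam g.
Proof.
elim/zgen: f => [|f h IHf IHh|a f IHf|j f IHf].
- by rewrite ev1 !mul1r.
- by rewrite mulrDl !(scalar_D (@ev_lin lam)) IHf IHh mulrDl.
- by rewrite -scalerAl !(scalar_Z (@ev_lin lam)) IHf mulrA.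
- by rewrite -mulrA !evzM IHf mulrA.
Qed.

Lemma D_Leibniz c f g : D c (f * g) = D c f * g + f * D c g.
Proof.
have cD := linear_D (D_lin c); have cZ := linear_Z (D_lin c).
elim/zgen: f => [|f h IHf IHh|a f IHf|j f IHf].
- by rewrite D1 mul0r add0r !mul1r.
- by rewrite mulrDl !cD IHf IHh; ring.
- by rewrite -scalerAl !cZ IHf scalerDr -!scalerAl.
- by rewrite -mulrA !DzM IHf mulrDr mulrDl -scalerAl !mulrA addrA.
Qed.

(** Leibniz rule, by induction on the order of the jet: composing with one more
    [D c] duplicates the sum, with [D c] on the left or on the right factors. *)
Lemma jet_sum_of_products X lam Phi : jet X lam Phi ->
  sum_of_products (jet X lam) (fun f g => Phi (f * g)).
Proof.
elim=> [|c Psi Xc jPsi IH].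
  have -> : (fun f g => ev lam (f * g)) = (fun f g => 1 * (ev lam f * ev lam g) + 0).
    by do 2 apply/funext => ?; rewrite ev_mult mul1r addr0.
  by apply: products_cons; [apply: jet_ev|apply: jet_ev|apply: products_nil].
have -> : (fun f g => Psi (D c (f * g)))
    = (fun f g => Psi (D c f * g) + Psi (f * D c g)).
  by do 2 apply/funext => ?; rewrite D_Leibniz (scalar_D (jet_scalar jPsi)).
apply: sum_of_productsD.
  suff H T : sum_of_products (jet X lam) T ->
      sum_of_products (jet X lam) (fun f g => T (D c f) g).
    exact: H IH.
  elim=> [|a Th Om T' jTh jOm _ IH']; first exact: products_nil.
  exact: (products_cons (Phi := fun f => Th (D c f)) a (jet_D Xc jTh) jOm IH').
suff H T : sum_of_products (jet X lam) T ->
    sum_of_products (jet X lam) (fun f g => T f (D c g)).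
  exact: H IH.
elim=> [|a Th Om T' jTh jOm _ IH']; first exact: products_nil.
exact: (products_cons (Psi := fun f => Om (D c f)) a jTh (jet_D Xc jOm) IH').
Qed.

Lemma sum_of_products_sub (Q Q' : (A -> K) -> Prop) T : (forall Phi, Q Phi -> Q' Phi) ->
  sum_of_products Q T -> sum_of_products Q' T.
Proof.
move=> QQ'; elim=> [|a Phi Psi T' QPhi QPsi _ IH]; first exact: products_nil.
by apply: products_cons => //; apply: QQ'.
Qed.

Lemma jets_sum_of_products Y X Phi : jets Y X Phi ->
  sum_of_products (fun Psi => exists2 lam, Y lam & jet X lam Psi)
    (fun f g => Phi (f * g)).
Proof.
elim=> [|a lam Psi Th Yl jPsi _ IH]; first exact: products_nil.
apply: sum_of_productsD => //; apply: sum_of_productsZ.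
by apply: sum_of_products_sub (jet_sum_of_products jPsi) => Om jOm; exists lam.
Qed.

End Representation.

(** * Directional derivatives *)

Section DirectionalDerivative.
Variables (K : closedFieldType) (A : comAlgType K) (z : nat -> A).
Variable pd : nat -> A -> A.
Hypothesis zgen : generates z.
Hypothesis pd_lin : forall j, linear (pd j).
Hypothesis pd1 : forall j, pd j 1 = 0.
Implicit Types (f g : A) (c : nat -> K).

Let product_rule j i f := pd j (z i * f) = (i == j)%:R *: f + z i * pd j f.

Lemma product_ruleD j i f g :
  product_rule j i f -> product_rule j i g -> product_rule j i (f + g).
Proof.
rewrite /product_rule mulrDr !(linear_D (@pd_lin j)) => -> ->.
by rewrite scalerDr mulrDr addrACA.
Qed.

Lemma product_ruleZ j i a f : product_rule j i f -> product_rule j i (a *: f).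
Proof.
rewrite /product_rule -scalerAr !(linear_Z (@pd_lin j)) => ->.
by rewrite scalerDr scalerAr !scalerA [a * _]mulrC.
Qed.

Hypothesis pdM : forall j i f, product_rule j i f.

(** Only finitely many variables occur in [f]. *)
Lemma pd_finite f : exists N, forall j, (N <= j)%N -> pd j f = 0.
Proof.
elim/zgen: f => [|f g [N HN] [M HM]|a f [N HN]|i f [N HN]].
- by exists 0%N => j _; rewrite pd1.
- exists (maxn N M) => j; rewrite geq_max (linear_D (@pd_lin j)).
  by move=> /andP[/HN -> /HM ->]; rewrite addr0.
- by exists N => j /HN; rewrite (linear_Z (@pd_lin j)) => ->; rewrite scaler0.
- exists (maxn N i.+1) => j; rewrite geq_max pdM => /andP[/HN -> ij].
  by rewrite mulr0 ltn_eqF // scale0r addr0.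
Qed.

Definition ddir c f : A := \sum_(j \in [set: nat]) c j *: pd j f.

Lemma ddirE c f N : (forall j, (N <= j)%N -> pd j f = 0) ->
  ddir c f = \sum_(j < N) c j *: pd j f.
Proof.
move=> HN; rewrite /ddir (fsbig_ord _ _ (fun j => c j *: pd j f)).
apply/esym/fsbig_widen => // j /= [_ /negP].
by rewrite -leqNgt => /HN ->; rewrite scaler0.
Qed.

Lemma ddir_is_linear c : linear (ddir c).
Proof.
move=> a f g.
have [N HN] := pd_finite f; have [M HM] := pd_finite g.
pose L := maxn N M.
have Hf j : (L <= j)%N -> pd j f = 0 by rewrite geq_max => /andP[/HN].
have Hg j : (L <= j)%N -> pd j g = 0 by rewrite geq_max => /andP[_ /HM].
rewrite (ddirE c Hf) (ddirE c Hg) (@ddirE c _ L).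
  rewrite scaler_sumr -big_split; apply: eq_bigr => j _ /=.
  by rewrite pd_lin scalerDr !scalerA [c j * _]mulrC.
by move=> j jL; rewrite pd_lin Hf // Hg // scaler0 addr0.
Qed.

Lemma ddirZ a c f : ddir (fun j => a * c j) f = a *: ddir c f.
Proof.
have [N HN] := pd_finite f; rewrite !(ddirE _ HN) scaler_sumr.
by apply: eq_bigr => j _; rewrite scalerA.
Qed.

Lemma ddir1 c : ddir c 1 = 0.
Proof. by rewrite (@ddirE _ _ 0%N) ?big_ord0 // => j _; apply: pd1. Qed.

Lemma ddir_zM c j f : ddir c (z j * f) = c j *: f + z j * ddir c f.
Proof.
have [N HN] := pd_finite f.
pose L := maxn N j.+1.
have Hf i : (L <= i)%N -> pd i f = 0 by rewrite geq_max => /andP[/HN].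
have jL : (j < L)%N by rewrite leq_maxr.
rewrite (ddirE c Hf) (@ddirE c _ L); last first.
  move=> i iL; rewrite pdM Hf // mulr0 addr0 ltn_eqF ?scale0r //.
  exact: leq_trans iL.
under eq_bigr do rewrite pdM scalerDr scalerAr.
rewrite big_split /= mulr_sumr; congr (_ + _).
  rewrite (bigD1 (Ordinal jL)) //= eqxx scale1r big1 ?addr0 // => i.
  rewrite -val_eqE /= eq_sym => /negPf ->.
  by rewrite scale0r scaler0.
Qed.

End DirectionalDerivative.

(** * The ring of polynomials *)

(** Locking keeps unification from unfolding products of polynomials into their
    defining sums over supports. *)
HB.lock Definition monom (R : realType) (k : cmonom nat) : cpoly R := mkmalgU k 1.
HB.lock Definition zvar (R : realType) (j : nat) : cpoly R := monom R (ucm j).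

Section PolynomialCalculus.
Variable R : realType.
Local Notation C := R[i].
Local Notation P := (cpoly R).
Implicit Types (f g : P) (c lam : nat -> C) (k l : cmonom nat).

Lemma mkmalgUM (a b : C) k l :
  mkmalgU (mmul k l) (a * b) = mkmalgU k a * mkmalgU l b :> P.
Proof. by rewrite malgM_def fgmulUU. Qed.

Lemma mkmalgUZ (a b : C) k : mkmalgU k (a * b) = a *: mkmalgU k b :> P.
Proof. by rewrite -mul_malgC -mkmalgUM mul1m. Qed.

Local Notation monom := (monom R).
Local Notation zvar := (zvar R).

Lemma zvarE j : zvar j = monom (ucm j).
Proof. by rewrite zvar.unlock. Qed.

Lemma monom1 : monom mone = 1.
Proof. by rewrite monom.unlock; exact (@mpolyC1E (cmonom nat) C). Qed.

Lemma monomM k l : monom (mmul k l) = monom k * monom l.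
Proof. by rewrite monom.unlock -mkmalgUM mulr1. Qed.

Lemma mkmalgU_monom a k : mkmalgU k a = a *: monom k :> P.
Proof. by rewrite monom.unlock -mkmalgUZ mulr1. Qed.

Lemma monomE f : f = \sum_(k <- msupp f) mcoeff k f *: monom k.
Proof. by rewrite {1}(monalgE f); apply: eq_bigr => k _; rewrite mkmalgU_monom. Qed.

Lemma monomial_ind (Q : cmonom nat -> Prop) :
  Q mone -> (forall j k, Q k -> Q (mmul (ucm j) k)) -> forall k, Q k.
Proof.
move=> Q1 QM k; have [n] := ubnP (mdeg k).
elim: n k => // n IHn k degk.
have [/mdeg_eq0I -> //|dk0] := eqVneq (mdeg k) 0%N.
have [j kj] : exists j, (0 < k j)%N.
  apply: contrapT => /forallNP H; move/eqP: dk0; apply.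
  by rewrite mdegE big1 // => j _; move/negP: (H j); rewrite lt0n negbK => /eqP.
have kE : k = mmul (ucm j) (divcm k (ucm j)).
  apply/eqP/cmP => i; rewrite cmM divcmE ucmE.
  by have [<-|_] := eqVneq j i; rewrite ?subn0 ?add0n // subnKC.
rewrite kE; apply/QM/IHn; rewrite -ltnS; apply: leq_trans degk.
by rewrite {2}kE mdegM mdegU.
Qed.

Lemma monom_spans (Q : P -> Prop) : (forall f g, Q f -> Q g -> Q (f + g)) ->
  (forall a f, Q f -> Q (a *: f)) -> (forall k, Q (monom k)) -> forall f, Q f.
Proof.
move=> QD QZ Qm f.
have Q0 : Q 0 by rewrite -(scale0r (monom mone)); apply: QZ.
rewrite (monomE f); apply: (big_ind Q Q0 QD) => k _.
by apply: QZ.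
Qed.

Lemma zvar_generates : generates zvar.
Proof.
move=> Q Q1 QD QZ Qz; apply: monom_spans => // k.
elim/monomial_ind: k => [|j k Qk]; first by rewrite monom1.
by rewrite monomM -zvarE; apply: Qz.
Qed.

Lemma cmonom_evalEw lam (d : {fset nat}) k : (finsupp k `<=` d)%fset ->
  cmonom_eval lam k = \prod_(j <- d) lam j ^+ k j.
Proof.
move=> kd; rewrite /cmonom_eval; apply: big_fset_incl kd _ => j _.
by rewrite -cmE_neq0 negbK => /eqP ->.
Qed.

Lemma cmonom_eval_mmorphism lam : mmorphism (cmonom_eval lam).
Proof.
split=> [k l|]; last by rewrite /cmonom_eval mdom1 big_seq_fset0.
rewrite /cmonom_eval mdomD -!/(cmonom_eval _ _).
rewrite (cmonom_evalEw lam (fsubsetUl _ (finsupp l))).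
rewrite (cmonom_evalEw lam (fsubsetUr (finsupp k) _)) -big_split /=.
by apply: eq_bigr => j _; rewrite cmM exprD.
Qed.

HB.instance Definition _ lam :=
  monalg.isMultiplicative.Build _ _ (cmonom_eval lam) (cmonom_eval_mmorphism lam).

Lemma cmonom_eval_ucm lam j : cmonom_eval lam (ucm j) = lam j.
Proof. by rewrite /cmonom_eval mdomU big_seq_fset1 cmUU. Qed.

Lemma pevalD lam f g : peval lam (f + g) = peval lam f + peval lam g.
Proof. exact: raddfD. Qed.

Lemma pevalM lam f g : peval lam (f * g) = peval lam f * peval lam g.
Proof. exact: rmorphM. Qed.

Lemma peval1 lam : peval lam 1 = 1.
Proof. exact: rmorph1. Qed.

Lemma pevalZ lam a f : peval lam (a *: f) = a * peval lam f.
Proof. exact: mmapZ. Qed.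

Lemma peval_zvar lam j : peval lam (zvar j) = lam j.
Proof. by rewrite zvarE monom.unlock /peval mmapU /= mul1r cmonom_eval_ucm. Qed.

Let dmonom j k : P := (k j)%:R *: monom (divcm k (ucm j)).

Lemma pderivEw (d : {fset cmonom nat}) j f : (msupp f `<=` d)%fset ->
  pderiv j f = \sum_(k <- d) mcoeff k f *: dmonom j k.
Proof.
move=> fd; rewrite /pderiv.
have E k : mkmalgU (divcm k (ucm j)) (mcoeff k f *+ k j) = mcoeff k f *: dmonom j k.
  by rewrite mkmalgU_monom /dmonom scalerA mulr_natr.
under eq_bigr do rewrite E.
apply: big_fset_incl fd _ => k _ /mcoeff_outdom ->.
by rewrite scale0r.
Qed.

Lemma pderiv_is_linear j : linear (@pderiv R j).
Proof.
move=> a f g.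
pose d := (msupp f `|` msupp g `|` msupp (a *: f + g))%fset.
rewrite !(@pderivEw d) ?fsubsetUr //; last first.
- by rewrite /d -fsetUA fsubsetUl.
- by rewrite /d fsetUAC fsubsetUr.
rewrite scaler_sumr -big_split; apply: eq_bigr => k _ /=.
by rewrite mcoeffD mcoeffZ scalerDl (scalerA a (mcoeff k f)).
Qed.

Lemma pderiv_monom j k : pderiv j (monom k) = dmonom j k.
Proof.
by rewrite monom.unlock (pderivEw _ (@msuppU_le _ _ k _)) big_seq_fset1 mcoeffUU scale1r.
Qed.

Lemma pderiv1 j : pderiv j (1 : P) = 0.
Proof. by rewrite -monom1 pderiv_monom /dmonom cm1 scale0r. Qed.

Lemma pderiv_zvar_monom j i k : pderiv j (zvar i * monom k) =
  (i == j)%:R *: monom k + zvar i * pderiv j (monom k).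
Proof.
rewrite zvarE -monomM !pderiv_monom /dmonom cmM ucmE.
rewrite -(scalerAr _ (monom (ucm i))) -monomM.
have [<-{j}|ij] := eqVneq i j.
  have -> : divcm (mmul (ucm i) k) (ucm i) = k.
    by apply/eqP/cmP => n; rewrite divcmE cmM addnC addnK.
  rewrite natrD scalerDl.
  have [->|ki] := posnP (k i); first by rewrite !scale0r.
  have -> // : mmul (ucm i) (divcm k (ucm i)) = k.
  apply/eqP/cmP => n; rewrite cmM divcmE ucmE.
  by have [<-|_] := eqVneq i n; rewrite ?subn0 ?add0n // subnKC.
rewrite scale0r !add0r add0n.
have -> // : divcm (mmul (ucm i) k) (ucm j) = mmul (ucm i) (divcm k (ucm j)).
apply/eqP/cmP => n; rewrite !(cmM, divcmE, ucmE).
have [<-|_] := eqVneq j n; last by rewrite !subn0.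
by rewrite (negPf ij).
Qed.

Lemma pderiv_zvarM j i f :
  pderiv j (zvar i * f) = (i == j)%:R *: f + zvar i * pderiv j f.
Proof.
apply: (monom_spans (Q := fun f => pderiv j (zvar i * f) = _ *: f + _)).
- exact: (@product_ruleD _ P zvar (@pderiv R) (@pderiv_is_linear) j i).
- exact: (@product_ruleZ _ P zvar (@pderiv R) (@pderiv_is_linear) j i).
- exact: pderiv_zvar_monom.
Qed.

Lemma dirderiv_is_linear c : linear (dirderiv c).
Proof.
exact: (ddir_is_linear zvar_generates pderiv_is_linear pderiv1 pderiv_zvarM).
Qed.

Lemma dirderivZ a c f : dirderiv (fun j => a * c j) f = a *: dirderiv c f.
Proof.
exact: (ddirZ zvar_generates pderiv_is_linear pderiv1 pderiv_zvarM).
Qed.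

Lemma dirderiv1 c : dirderiv c (1 : P) = 0.
Proof. exact: (ddir1 (A := P) pderiv1). Qed.

Lemma dirderiv_zvarM c j f :
  dirderiv c (zvar j * f) = c j *: f + zvar j * dirderiv c f.
Proof.
exact: (ddir_zM zvar_generates pderiv_is_linear pderiv1 pderiv_zvarM).
Qed.

Lemma peval_is_scalar lam : scalar (peval lam).
Proof. by move=> a f g; rewrite pevalD pevalZ. Qed.

Lemma peval_zvarM lam j f : peval lam (zvar j * f) = lam j * peval lam f.
Proof. by rewrite pevalM peval_zvar. Qed.

Lemma zkappaE n : zkappa R n = monom (kappa n).
Proof. by rewrite monom.unlock. Qed.

End PolynomialCalculus.

(** * Primes, multi-indices and multiplicative sums *)

Section PrimeIndexing.

Lemma prime_indexS p : prime_index p.+1 = (prime_index p + prime p)%N.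
Proof. by rewrite /prime_index big_ord_recr. Qed.

Lemma leq_prime_index : {homo prime_index : p q / (p <= q)%N}.
Proof.
apply: homo_leq => // [q p r|p]; first exact: leq_trans.
by rewrite prime_indexS leq_addr.
Qed.

Lemma sum_prime_index (V : nmodType) (F : nat -> V) k :
  \sum_(p < k | prime p) F (prime_index p) = \sum_(j < prime_index k) F j.
Proof.
elim: k => [|k IHk]; first by rewrite /prime_index !big_ord0.
rewrite big_mkcond big_ord_recr /= -big_mkcond IHk prime_indexS.
by case: (prime k); rewrite ?addn1 ?big_ord_recr //= addn0 addr0.
Qed.

Lemma prime_index_unbounded j : exists k, (j < prime_index k)%N.
Proof.
elim: j => [|j [k jk]].
  by exists 3; rewrite /prime_index !big_ord_recr big_ord0.
have [p kp p_pr] := prime_above k; exists p.+1.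
rewrite prime_indexS p_pr addn1 ltnS; apply: leq_trans jk _.
exact/leq_prime_index/ltnW.
Qed.

Lemma prime_index_surj j : exists2 p, prime p & prime_index p = j.
Proof.
have [k jk min_k] := ex_minnP (prime_index_unbounded j).
case: k jk min_k => [|p]; first by rewrite /prime_index big_ord0.
rewrite prime_indexS => jp min_p.
have pj : (prime_index p <= j)%N.
  by rewrite leqNgt; apply/negP => /min_p; rewrite ltnn.
have p_pr : prime p by case: (prime p) jp => //; rewrite addn0 ltnNge pj.
exists p => //; apply/eqP; rewrite eqn_leq pj -ltnS.
by rewrite p_pr addn1 in jp.
Qed.

Lemma expcmnE (c : cmonom nat) n i : expcmn c n i = (n * c i)%N.
Proof.
have -> : expcmn c n = iter n (mmul c) mone.
  by rewrite /expcmn -[LHS]/(iterop n mmul c mone) Monoid.iteropE.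
by elim: n => [|n IHn]; rewrite ?cm1 //= cmM IHn mulSn.
Qed.

Lemma expcmnD (c : cmonom nat) m n :
  expcmn c (m + n) = mmul (expcmn c m) (expcmn c n).
Proof. by apply/eqP/cmP => i; rewrite cmM !expcmnE mulnDl. Qed.

(** With a common range of primes, multiplicativity is that of [logn]. *)
Lemma kappaEw n k : (n < k)%N -> kappa n =
  \big[mmul/mone]_(p < k | prime p) expcmn (ucm (prime_index p)) (logn p n).
Proof.
move=> nk; rewrite /kappa.
rewrite -(big_mkord prime (fun p => expcmn (ucm (prime_index p)) (logn p n))).
have /(perm_big _) -> /= : perm_eq (primes n) [seq p <- index_iota 0 k | p \in primes n].
  apply: uniq_perm; rewrite ?primes_uniq ?filter_uniq ?iota_uniq // => p.
  rewrite mem_filter mem_index_iota /=.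
  case pn: (p \in primes n) => //=; apply/esym.
  move: pn; rewrite mem_primes => /and3P[_ n_gt0 /dvdn_leq -/(_ n_gt0) pn].
  exact: leq_ltn_trans nk.
rewrite big_filter big_mkcond [RHS]big_mkcond; apply: eq_bigr => p _ /=.
case pn: (p \in primes n); first by move: pn; rewrite mem_primes => /andP[->].
case: ifP => // p_pr; apply/eqP/cmP => i; rewrite expcmnE cm1.
by rewrite (_ : logn p n = 0%N) //; apply/eqP; rewrite -leqn0 leqNgt logn_gt0 pn.
Qed.

Lemma kappaM m n : (0 < m)%N -> (0 < n)%N ->
  kappa (m * n) = mmul (kappa m) (kappa n).
Proof.
move=> m_gt0 n_gt0.
have mn_m : (m < (m * n).+1)%N by rewrite ltnS leq_pmulr.
have mn_n : (n < (m * n).+1)%N by rewrite ltnS leq_pmull.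
rewrite (kappaEw (ltnSn _)) (kappaEw mn_m) (kappaEw mn_n) -big_split /=.
by apply: eq_bigr => p _; rewrite lognM // expcmnD.
Qed.

Lemma kappa1 : kappa 1 = mone.
Proof. by rewrite /kappa big_nil. Qed.

Lemma kappa_prime p : prime p -> kappa p = ucm (prime_index p).
Proof.
move=> p_pr; rewrite /kappa primes_prime // big_seq1 logn_prime // eqxx.
by apply/eqP/cmP => i; rewrite expcmnE mul1n.
Qed.

End PrimeIndexing.

Section SmoothSums.
Variables (R : realType) (a : nat -> R) (r : R).
Hypothesis a1 : a 1%N = 1.
Hypothesis aM : forall m n, (0 < m)%N -> (0 < n)%N -> a (m * n)%N = a m * a n.
Hypothesis a_ge0 : forall n, 0 <= a n.
Hypothesis r_lt1 : r < 1.
Hypothesis a_prime : forall p, prime p -> a p <= r.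

Let smooth k n := (0 < n)%N && all (fun p => p < k)%N (primes n).
(* The smooth numbers up to N; the truncation keeps all sums finite. *)
Let T k N := \sum_(n < N.+1 | smooth k n) a n.

(** The multiples of k among the (k+1)-smooth numbers up to N are k times such
    numbers; the others are k-smooth. *)
Lemma smooth_sumS k N : prime k -> T k.+1 N <= T k N + a k * T k.+1 N.
Proof.
move=> k_pr; have k_gt0 := prime_gt0 k_pr.
rewrite {1}/T (bigID (fun n : 'I_N.+1 => (k %| n)%N)) /= addrC; apply: lerD.
  rewrite /T big_mkcond [leRHS]big_mkcond; apply: ler_sum => n _ /=.
  case: ifP => [/andP[/andP[n_gt0 /allP sm] kn]|_]; last by case: ifP.
  suff -> : smooth k n by [].
  rewrite /smooth n_gt0; apply/allP => p p_n.
  have := sm p p_n; rewrite ltnS leq_eqVlt => /orP[/eqP pk|//].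
  by move: p_n kn; rewrite pk mem_primes => /and3P[_ _ ->].
rewrite (partition_big (fun n : 'I_N.+1 => inord (n %/ k) : 'I_N.+1)
  (fun m => smooth k.+1 m)) /=.
  rewrite /T mulr_sumr; apply: ler_sum => m /andP[m_gt0 _].
  rewrite -aM //.
  have nE (n : 'I_N.+1) : (smooth k.+1 n && (k %| n)%N) && (inord (n %/ k) == m) ->
      n = (k * m)%N :> nat.
    case/andP=> /andP[_ kn] /eqP <-; rewrite inordK; first by rewrite mulnC divnK.
    by rewrite ltnS (leq_trans (leq_div _ _)) // -ltnS.
  have [kmN|kmN] := ltnP (k * m)%N N.+1; last first.
    rewrite big_pred0 // => n; apply/negP => /nE nkm.
    by move: (ltn_ord n); rewrite ltnNge nkm kmN.
  rewrite big_mkcond (bigD1 (Ordinal kmN)) //= big1 => [|n nkm].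
    by rewrite addr0; case: ifP.
  case: ifP => // /nE nE'; case/eqP: nkm; exact: val_inj.
move=> n /andP[/andP[n_gt0 sm] kn].
have nk : (n %/ k < N.+1)%N by rewrite ltnS (leq_trans (leq_div _ _)) // -ltnS.
have nk_gt0 : (0 < n %/ k)%N by rewrite divn_gt0 // dvdn_leq.
rewrite inordK // /smooth nk_gt0; apply/allP => p p_n; apply: (allP sm).
move: p_n; rewrite !mem_primes n_gt0 nk_gt0 /= => /andP[-> pn] /=.
exact: dvdn_trans pn (dvdn_div kn).
Qed.

(** Solving the previous inequality gives one Euler factor [(1 - a k)^-1], and
    [(1 - x)^-1 <= 1 + x / (1 - r) <= exp (x / (1 - r))] for [0 <= x <= r]. *)
Lemma smooth_sum_le k N :
  T k N <= expR ((1 - r)^-1 * \sum_(p < k | prime p) a p).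
Proof.
have r1 : 0 < 1 - r by rewrite subr_gt0.
elim: k => [|k IHk].
  have sm0 n : smooth 0 n = (n == 1%N).
    apply/andP/eqP => [[n_gt0 /allP sm]|-> //].
    apply/eqP; rewrite eqn_leq n_gt0 andbT leqNgt; apply/negP => n_gt1.
    by have := sm (pdiv n); rewrite mem_primes pdiv_prime // pdiv_dvd n_gt0 => /(_ isT).
  rewrite big_ord0 mulr0 expR0 /T.
  under eq_bigl => n do rewrite sm0.
  case: N => [|N']; first by rewrite big_pred0 ?ler01 // => -[[|]].
  rewrite (big_pred1 (inord 1)) => [|n]; last by rewrite [pred1 _ _]/= -val_eqE /= inordK.
  by rewrite inordK ?a1.
rewrite [X in _ * X]big_mkcond big_ord_recr /= -big_mkcond.
case: ifP => k_pr; last first.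
  rewrite addr0; apply: le_trans IHk; rewrite /T big_mkcond [leRHS]big_mkcond.
  apply: ler_sum => n _ /=; case: ifP => [/andP[n_gt0 /allP sm]|_]; last by case: ifP.
  suff -> : smooth k n by [].
  rewrite /smooth n_gt0; apply/allP => p p_n.
  have := sm p p_n; rewrite ltnS leq_eqVlt => /orP[/eqP pk|//].
  by move: p_n; rewrite pk mem_primes k_pr.
have akr := a_prime k_pr; have ak1 : 0 < 1 - a k by lra.
have T1 : T k.+1 N <= (1 - a k)^-1 * T k N.
  by rewrite mulrC ler_pdivlMr //; have := smooth_sumS N k_pr; lra.
apply: (le_trans T1); rewrite mulrDr expRD mulrC; apply: ler_pM => //.
- by apply: sumr_ge0 => n _.
- by rewrite invr_ge0 ltW.
apply: le_trans (expR_ge1Dx _).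
have -> : (1 - a k)^-1 = 1 + (1 - a k)^-1 * a k by field; apply/eqP; lra.
rewrite lerD2l ler_wpM2r // lef_pV2 ?posrE //; lra.
Qed.

(** The integers up to N are (N+1)-smooth, so they fall under the Euler product. *)
Lemma multiplicative_sum_le S : (forall k, \sum_(p < k | prime p) a p <= S) ->
  forall N, \sum_(n < N) a n.+1 <= expR ((1 - r)^-1 * S).
Proof.
move=> HS N; have r1 : 0 < 1 - r by rewrite subr_gt0.
apply: (@le_trans _ _ (T N.+1 N)).
  rewrite /T [leRHS]big_mkcond [leRHS]big_ord_recl /= add0r; apply: ler_sum => n _.
  rewrite /bump /= add1n ifT //; apply/allP => p.
  by rewrite mem_primes => /and3P[_ _ /dvdn_leq pn]; rewrite ltnS (leq_trans (pn _)).
apply: le_trans (smooth_sum_le _ _) _.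
by rewrite ler_expR ler_wpM2l // invr_ge0 ltW.
Qed.

End SmoothSums.

(** * Square summable sequences and bounded matrices *)

Section SquareSummability.
Local Open Scope classical_set_scope.
Local Open Scope ring_scope.
Variable R : realType.
Local Notation C := R[i].
Local Notation normc := (@Normc.normc R).
Local Notation Re := (@complex.Re R).
Local Notation Im := (@complex.Im R).
Implicit Types (x y : nat -> C) (A : nat -> nat -> C).

Lemma sqr_normc_ReIm (u : C) : normc u ^+ 2 = Re u ^+ 2 + Im u ^+ 2.
Proof. by case: u => a b /=; rewrite sqr_sqrtr // addr_ge0 ?sqr_ge0. Qed.

Lemma normc_ge0 (u : C) : 0 <= normc u.
Proof. by case: u => a b /=; rewrite sqrtr_ge0. Qed.

Lemma normc_Re (u : C) : `|Re u| <= normc u.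
Proof.
rewrite -(@ler_pXn2r _ 2) ?nnegrE ?normc_ge0 // sqr_normc_ReIm real_normK ?num_real //.
by rewrite lerDl sqr_ge0.
Qed.

Lemma normc_Im (u : C) : `|Im u| <= normc u.
Proof.
rewrite -(@ler_pXn2r _ 2) ?nnegrE ?normc_ge0 // sqr_normc_ReIm real_normK ?num_real //.
by rewrite lerDr sqr_ge0.
Qed.

Lemma normC_normc (u : C) : `|u| = (normc u)%:C%C.
Proof. by rewrite normc_def; case: u. Qed.

Lemma normc_sum n (F : 'I_n -> C) : normc (\sum_i F i) <= \sum_i normc (F i).
Proof.
elim: n F => [|n IHn] F; first by rewrite !big_ord0 Normc.normc0.
rewrite !big_ord_recr /=; apply: le_trans (le_normcD _ _) _.
by rewrite lerD2r.
Qed.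

Lemma sqr_normcD (u v : C) : normc (u + v) ^+ 2 <= 2 * normc u ^+ 2 + 2 * normc v ^+ 2.
Proof.
rewrite !sqr_normc_ReIm; case: u v => [a b] [c d] /=.
have := sqr_ge0 (a - c); have := sqr_ge0 (b - d); nra.
Qed.

Lemma l2norm_sqr_le x (S : R) : (forall N, \sum_(n < N) normc (x n) ^+ 2 <= S) ->
  (l2norm_sqr x <= S%:E)%E.
Proof.
move=> HS; apply: lime_le.
  by apply: is_cvg_nneseries => n _ _; rewrite lee_fin sqr_ge0.
by apply: nearW => N; rewrite sumEFin big_mkord lee_fin.
Qed.

Lemma l2norm_sqr_ge x N : ((\sum_(n < N) normc (x n) ^+ 2)%:E <= l2norm_sqr x)%E.
Proof.
rewrite -(big_mkord xpredT (fun n => normc (x n) ^+ 2)) -sumEFin.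
by apply: nneseries_lim_ge => n _ _; rewrite lee_fin sqr_ge0.
Qed.

Lemma in_l2P x : in_l2 x <-> exists S, forall N, \sum_(n < N) normc (x n) ^+ 2 <= S.
Proof.
split=> [xl2|[S HS]]; last by apply: le_lt_trans (l2norm_sqr_le HS) (ltry _).
exists (fine (l2norm_sqr x)) => N; rewrite -lee_fin fineK ?l2norm_sqr_ge //.
rewrite ge0_fin_numE //; apply: le_trans (l2norm_sqr_ge x 0).
by rewrite big_ord0.
Qed.

Lemma in_l2D x y : in_l2 x -> in_l2 y -> in_l2 (fun n => x n + y n).
Proof.
move=> /in_l2P[S HS] /in_l2P[T HT]; apply/in_l2P; exists (2 * S + 2 * T) => N.
apply: (@le_trans _ _ (\sum_(n < N) (2 * normc (x n) ^+ 2 + 2 * normc (y n) ^+ 2))).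
  by apply: ler_sum => n _; apply: sqr_normcD.
rewrite big_split /= -!mulr_sumr; have := HS N; have := HT N; lra.
Qed.

Lemma in_l2Z a x : in_l2 x -> in_l2 (fun n => a * x n).
Proof.
move=> /in_l2P[S HS]; apply/in_l2P; exists (normc a ^+ 2 * S) => N.
under eq_bigr do rewrite Normc.normcM exprMn.
by rewrite -mulr_sumr ler_wpM2l ?sqr_ge0.
Qed.

Lemma in_l2_delta m : in_l2 (fun n => (n == m)%:R : C).
Proof.
apply/in_l2P; exists 1 => N.
have E n : normc (n == m)%:R ^+ 2 = (n == m)%:R.
  by case: eqP; rewrite ?Normc.normc0 ?Normc.normc1 ?expr0n ?expr1n.
under eq_bigr do rewrite E.
have [mN|Nm] := ltnP m N.
  rewrite (bigD1 (Ordinal mN)) //= eqxx big1 ?addr0 // => n.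
  by rewrite -val_eqE /= => /negPf ->.
rewrite big1 // => n _; rewrite ltn_eqF //; exact: leq_trans (ltn_ord n) Nm.
Qed.

Lemma cauchy_schwarz n (a b : 'I_n -> R) :
  (\sum_i a i * b i) ^+ 2 <= (\sum_i a i ^+ 2) * (\sum_i b i ^+ 2).
Proof.
elim: n a b => [|n IHn] a b; first by rewrite !big_ord0 expr0n mul0r.
rewrite !big_ord_recr /=.
set s := \sum_i _; set P := \sum_i _; set Q := \sum_i _.
have sPQ : s ^+ 2 <= P * Q := IHn _ _.
have P0 : 0 <= P by apply: sumr_ge0 => i _; apply: sqr_ge0.
have Q0 : 0 <= Q by apply: sumr_ge0 => i _; apply: sqr_ge0.
move: (a _) (b _) => u v; clearbody s P Q.
have key : 2 * s * (u * v) <= P * v ^+ 2 + u ^+ 2 * Q.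
  apply: le_trans (ler_norm _) _.
  rewrite -(@ler_pXn2r _ 2) ?nnegrE //; last first.
    by apply: addr_ge0; apply: mulr_ge0 => //; apply: sqr_ge0.
  rewrite real_normK ?num_real //.
  apply: (@le_trans _ _ (4 * (P * Q) * (u * v) ^+ 2)).
    have -> : (2 * s * (u * v)) ^+ 2 = 4 * s ^+ 2 * (u * v) ^+ 2 by ring.
    by rewrite ler_wpM2r ?sqr_ge0 // ler_pM2l.
  rewrite -subr_ge0.
  have -> : (P * v ^+ 2 + u ^+ 2 * Q) ^+ 2 - 4 * (P * Q) * (u * v) ^+ 2 =
    (P * v ^+ 2 - u ^+ 2 * Q) ^+ 2 by ring.
  exact: sqr_ge0.
have -> : (s + u * v) ^+ 2 = s ^+ 2 + 2 * s * (u * v) + u ^+ 2 * v ^+ 2 by ring.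
have -> : (P + u ^+ 2) * (Q + v ^+ 2) =
  P * Q + (P * v ^+ 2 + u ^+ 2 * Q) + u ^+ 2 * v ^+ 2 by ring.
by rewrite lerD2r lerD.
Qed.

Definition hilbert_schmidt A : Prop :=
  exists S, forall N M, \sum_(n < N) \sum_(m < M) normc (A n m) ^+ 2 <= S.

Lemma hilbert_schmidt0 : hilbert_schmidt (fun _ _ => 0).
Proof.
exists 0 => N M; rewrite big1 // => n _; rewrite big1 // => m _.
by rewrite Normc.normc0 expr0n.
Qed.

Lemma hilbert_schmidtD A B : hilbert_schmidt A -> hilbert_schmidt B ->
  hilbert_schmidt (fun n m => A n m + B n m).
Proof.
move=> [S HS] [T HT]; exists (2 * S + 2 * T) => N M.
apply: (@le_trans _ _ (\sum_(n < N) \sum_(m < M)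
    (2 * normc (A n m) ^+ 2 + 2 * normc (B n m) ^+ 2))).
  by apply: ler_sum => n _; apply: ler_sum => m _; apply: sqr_normcD.
under eq_bigr do rewrite big_split /= -!mulr_sumr.
rewrite big_split /= -!mulr_sumr; have := HS N M; have := HT N M; lra.
Qed.

Lemma hilbert_schmidt_tensor x y : in_l2 x -> in_l2 y ->
  hilbert_schmidt (fun n m => x n * y m).
Proof.
move=> /in_l2P[S HS] /in_l2P[T HT]; exists (S * T) => N M.
under eq_bigr => n _ do under eq_bigr do rewrite Normc.normcM exprMn.
under eq_bigr do rewrite -mulr_sumr.
rewrite -mulr_suml; apply: ler_pM => //; apply: sumr_ge0 => i _; exact: sqr_ge0.
Qed.

(** The real and imaginary parts converge absolutely. Their limits are part of the
    conclusion because bounds on the limit are proved through them. *)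
Lemma absolutely_cvg_series (u : nat -> C) B :
    (forall M, \sum_(m < M) normc (u m) <= B) ->
  exists l : C, [/\ series (u : nat -> C^o) @ \oo --> (l : C^o),
    (fun M => Re (\sum_(m < M) u m)) @ \oo --> Re l &
    (fun M => Im (\sum_(m < M) u m)) @ \oo --> Im l].
Proof.
move=> HB.
have cvg_part (f : C -> R) : (forall v, `|f v| <= normc v) ->
    cvgn (series (f \o u)).
  move=> fle; apply: normed_cvg; apply: nondecreasing_is_cvgn.
    by apply: nondecreasing_series => n _ _ /=; apply: normr_ge0.
  exists B => _ [M _ <-]; rewrite /= seriesEord.
  by apply: le_trans (HB M); apply: ler_sum => m _; apply: fle.
have /cvg_ex [/= a Ha] := cvg_part _ normc_Re.
have /cvg_ex [/= b Hb] := cvg_part _ normc_Im.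
have ReE M : Re (\sum_(m < M) u m) = series (Re \o u) M.
  by rewrite /series /= big_mkord (raddf_sum (Re : Rcomplex R -> R)).
have ImE M : Im (\sum_(m < M) u m) = series (Im \o u) M.
  by rewrite /series /= big_mkord (raddf_sum (Im : Rcomplex R -> R)).
exists (Complex a b); split => /=; last 2 first.
- by under eq_fun do rewrite ReE.
- by under eq_fun do rewrite ImE.
apply/cvgrPdist_lt => e e_gt0.
have eE : e = (Re e)%:C%C by rewrite RRe_real // gtr0_real.
have e2_gt0 : 0 < Re e / 2 by rewrite divr_gt0 // -ltcR -eE.
move/cvgrPdist_lt: Ha => /(_ _ e2_gt0) Ha.
move/cvgrPdist_lt: Hb => /(_ _ e2_gt0) Hb.
near=> M.
rewrite eE normC_normc ltcR.
have Ma : `|a - series (Re \o u) M| < Re e / 2 by near: M.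
have Mb : `|b - series (Im \o u) M| < Re e / 2 by near: M.
set w := _ - _.
have wE : w = Complex (a - series (Re \o u) M) (b - series (Im \o u) M).
  by rewrite /w -ReE -ImE /series /= big_mkord; case: (\sum_(i < M) u i).
rewrite -(@ltr_pXn2r _ 2) ?nnegrE ?normc_ge0 //; last by lra.
rewrite sqr_normc_ReIm wE /=.
rewrite -[(a - _) ^+ 2]real_normK ?num_real // -[(b - _) ^+ 2]real_normK ?num_real //.
have := normr_ge0 (a - series (Re \o u) M).
have := normr_ge0 (b - series (Im \o u) M).
nra.
Unshelve. all: by end_near.
Qed.

Lemma cvg_sum_ord N (f : 'I_N -> nat -> R) (l : 'I_N -> R) :
  (forall n, f n @ \oo --> l n) -> (fun M => \sum_n f n M) @ \oo --> \sum_n l n.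
Proof.
elim: N f l => [|N IHN] f l Hf.
  by under eq_fun do rewrite big_ord0; rewrite big_ord0; apply: cvg_cst.
under eq_fun do rewrite big_ord_recr; rewrite big_ord_recr.
by apply: cvgD => //; apply: IHN.
Qed.

(** The Cauchy-Schwarz inequality bounds every finite section uniformly; the
    number of columns tends to infinity first, with the number of rows fixed. *)
Lemma hilbert_schmidt_bounded A : hilbert_schmidt A -> bounded_matrix A.
Proof.
move=> [S HS]; exists (Num.sqrt S) => x xl2 Ax.
have S_ge0 : 0 <= S by have := HS 0%N 0%N; rewrite big_ord0.
have Xfin : l2norm_sqr x \is a fin_num.
  rewrite ge0_fin_numE //; apply: le_trans (l2norm_sqr_ge x 0).
  by rewrite big_ord0.
pose X := fine (l2norm_sqr x).
have HX M : \sum_(m < M) normc (x m) ^+ 2 <= X.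
  by rewrite -lee_fin fineK ?l2norm_sqr_ge.
have row n M : \sum_(m < M) normc (A n m) ^+ 2 <= S.
  apply: le_trans (HS n.+1 M); rewrite big_ord_recr /= lerDr.
  by apply: sumr_ge0 => i _; apply: sumr_ge0 => j _; apply: sqr_ge0.
have abs n M : \sum_(m < M) normc (A n m * x m) <= S + X.
  apply: (@le_trans _ _ (\sum_(m < M) (normc (A n m) ^+ 2 + normc (x m) ^+ 2))).
    apply: ler_sum => m _; rewrite Normc.normcM.
    have := normc_ge0 (A n m); have := normc_ge0 (x m).
    have := sqr_ge0 (normc (A n m) - normc (x m)); nra.
  by rewrite big_split lerD.
have [l Hl] := choice (fun n =>
  @absolutely_cvg_series (fun m => A n m * x m) _ (abs n)).
have limE n : limn (Ax n) = l n by case: (Hl n) => Hn _ _; apply: cvg_lim.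
split=> [n|]; first by apply/cvg_ex; exists (l n); case: (Hl n).
rewrite sqr_sqrtr // -(fineK Xfin) -EFinM; apply: l2norm_sqr_le => N.
under eq_bigr do rewrite limE sqr_normc_ReIm.
pose F n M := Re (\sum_(m < M) A n m * x m) ^+ 2 + Im (\sum_(m < M) A n m * x m) ^+ 2.
have cvgF : (fun M => \sum_(n < N) F n M) @ \oo -->
    \sum_(n < N) (Re (l n) ^+ 2 + Im (l n) ^+ 2).
  apply: (@cvg_sum_ord N (fun n => F n) (fun n => Re (l n) ^+ 2 + Im (l n) ^+ 2)) => n.
  case: (Hl n) => _ cRe cIm.
  by apply: cvgD; rewrite !expr2; apply: cvgM.
apply: (cvgr_to_le cvgF); apply: nearW => M.
apply: (@le_trans _ _ (\sum_(n < N) (\sum_(m < M) normc (A n m) ^+ 2) * X)); last first.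
  by rewrite -mulr_suml ler_wpM2r //; apply: le_trans (HX 0%N); rewrite big_ord0.
apply: ler_sum => n _; rewrite /F -sqr_normc_ReIm.
apply: (@le_trans _ _ ((\sum_(m < M) normc (A n m) * normc (x m)) ^+ 2)).
  rewrite ler_pXn2r ?nnegrE ?normc_ge0 //; last first.
    by apply: sumr_ge0 => m _; rewrite mulr_ge0 ?normc_ge0.
  apply: le_trans (normc_sum _) _.
  by under eq_bigr do rewrite Normc.normcM.
apply: le_trans (cauchy_schwarz _ _) _.
by apply: ler_wpM2l => //; apply: sumr_ge0 => m _; apply: sqr_ge0.
Qed.

(** A column is the image of a basis vector. *)
Lemma bounded_column A m : bounded_matrix A -> in_l2 (fun n => A n m).
Proof.
move=> [K HK]; have [_ ] := HK _ (in_l2_delta m).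
have limE n : limn (series (fun i => A n i * (i == m)%:R : C^o)) = A n m.
  apply: lim_near_cst; first exact: norm_hausdorff.
  exists m.+1 => // M /= mM; rewrite /series /= big_mkord.
  rewrite (bigD1 (Ordinal mM)) //= eqxx mulr1 big1 ?addr0 // => i.
  by rewrite -val_eqE /= => /negPf ->; rewrite mulr0.
under eq_fun do rewrite limE.
move=> H; apply: le_lt_trans H _.
have := in_l2_delta m; rewrite /in_l2.
have : (0 <= l2norm_sqr (fun n => (n == m)%:R : C))%E.
  by apply: le_trans (l2norm_sqr_ge _ 0); rewrite big_ord0.
by case: l2norm_sqr => // r _ _; rewrite -EFinM ltry.
Qed.

End SquareSummability.

(** * Square summability along the positive integers *)

(** Here [zk n] stands for the monomial [z^kappa(n)]. *)

Section HelsonSequences.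
Local Open Scope classical_set_scope.
Local Open Scope ring_scope.
Variable R : realType.
Local Notation C := R[i].
Local Notation normc := (@Normc.normc R).
Variables (A : comAlgType C) (z : nat -> A) (zk : nat -> A).
Variables (D : (nat -> C) -> A -> A) (ev : (nat -> C) -> A -> C).
Hypothesis zgen : generates z.
Hypothesis D_lin : forall c, linear (D c).
Hypothesis D1 : forall c, D c 1 = 0.
Hypothesis DzM : forall c j f, D c (z j * f) = c j *: f + z j * D c f.
Hypothesis ev_lin : forall lam, scalar (ev lam).
Hypothesis ev1 : forall lam, ev lam 1 = 1.
Hypothesis evzM : forall lam j f, ev lam (z j * f) = lam j * ev lam f.
Hypothesis zk1 : zk 1 = 1.
Hypothesis zkM : forall m n, (0 < m)%N -> (0 < n)%N -> zk (m * n) = zk m * zk n.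
Hypothesis zk_prime : forall p, prime p -> zk p = z (prime_index p).
Implicit Types (f g h : A) (c lam x : nat -> C) (Phi Psi phi : A -> C).

Let ev_M := ev_mult zgen ev_lin ev1 evzM.

Lemma normc_real (t : R) : 0 <= t -> normc t%:C%C = t.
Proof. by move=> t0; rewrite /= expr0n addr0 sqrtr_sqr ger0_norm. Qed.

(** Otherwise infinitely many terms, rescaled by [e^-1], contribute at least 1 to
    the sum of squares. *)
Lemma in_l2_small x e : in_l2 x -> 0 < e ->
  exists N, forall n, (N <= n)%N -> normc (x n) < e.
Proof.
move=> xl2 e_gt0; have /in_l2P[S HS] := in_l2Z (e^-1)%:C%C xl2.
apply: contrapT => /forallNP H.
have big K : exists N, K%:R <= \sum_(n < N) normc ((e^-1)%:C%C * x n) ^+ 2.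
  elim: K => [|K [N HN]]; first by exists 0%N; rewrite big_ord0.
  have /existsNP [n /not_implyP [Nn /negP]] := H N.
  rewrite -leNgt => en; exists n.+1; rewrite big_ord_recr /= -natr1; apply: lerD.
    apply: (le_trans HN); rewrite -(subnKC Nn) big_split_ord /= lerDl.
    by apply: sumr_ge0 => i _; apply: sqr_ge0.
  rewrite Normc.normcM normc_real ?invr_ge0 ?(ltW e_gt0) // mulrC.
  rewrite exprn_ege1 // ler_pdivlMr // mul1r //.
have [N HN] := big (Num.truncn S).+1.
have := le_lt_trans (le_trans HN (HS N)) (truncnS_gt S).
by rewrite ltxx.
Qed.

(** The variables are the [zk p] for p prime: this is a subsequence. *)
Lemma in_l2_primes (F : A -> C) : in_l2 (fun n => F (zk n.+1)) ->
  in_l2 (fun j => F (z j)).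
Proof.
move=> /in_l2P[S HS]; apply/in_l2P; exists S => N.
have [[|k] Nk] := prime_index_unbounded N; first by rewrite /prime_index big_ord0 in Nk.
apply: (@le_trans _ _ (\sum_(j < prime_index k.+1) normc (F (z j)) ^+ 2)).
  rewrite -(subnKC (ltnW Nk)) big_split_ord /= lerDl.
  by apply: sumr_ge0 => i _; apply: sqr_ge0.
rewrite -(sum_prime_index (fun j => normc (F (z j)) ^+ 2)).
rewrite big_mkcond big_ord_recl /= add0r; apply: le_trans (HS k).
apply: ler_sum => n _; rewrite /bump /= add1n.
by case: ifP => [/zk_prime ->|_] //; apply: sqr_ge0.
Qed.

Section BoundedColumns.
Variable phi : A -> C.
Hypothesis phi_lin : scalar phi.
Hypothesis phi_l2 : forall m, (0 < m)%N -> in_l2 (fun n => phi (zk (n.+1 * m))).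

(** The columns are the multiples by the monomials [zk m], which span. *)
Lemma in_l2_multiple h : in_l2 (fun n => phi (zk n.+1 * h)).
Proof.
suff : forall m, (0 < m)%N -> in_l2 (fun n => phi (zk n.+1 * (zk m * h))).
  by move=> /(_ 1%N isT); under eq_fun do rewrite zk1 mul1r.
elim/zgen: h => [|f g IHf IHg|a f IHf|j f IHf] m m_gt0.
- by under eq_fun do rewrite mulr1 -zkM //; apply: phi_l2.
- under eq_fun do rewrite !mulrDr (scalar_D phi_lin).
  by apply: in_l2D; [apply: IHf|apply: IHg].
- under eq_fun do rewrite -!scalerAr (scalar_Z phi_lin).
  by apply: in_l2Z; apply: IHf.
- have [p p_pr <-] := prime_index_surj j.
  have := IHf (m * p)%N; rewrite muln_gt0 m_gt0 prime_gt0 // => /(_ isT).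
  congr in_l2; apply/funext => n.
  by rewrite -zk_prime // zkM ?(prime_gt0 p_pr) // -mulrA.
Qed.

(** Some [g * h] is a joint eigenvector modulo the radical, so that
    [phi (f * (g * h))] is a non-zero multiple of [ev lam f], and the evaluation at
    lam inherits square summability from phi. *)
Lemma point_of_radical N lam h : killed z (radical phi) (nseq N lam) h ->
    ~ radical phi h ->
  (in_polydisc lam /\ in_l2 lam) /\
  forall g, in_l2 (fun j => phi ((z j - (lam j)%:A) * (g * h))).
Proof.
move=> kh NIh; have idI := radical_ideal phi_lin.
have [g [NIg Hg]] := killed_eigenvector idI kh NIh.
have phiE f : phi (f * (g * h)) = ev lam f * phi (g * h).
  elim/zgen: f => [|f f' IHf IHf'|a f IHf|j f IHf].
  - by rewrite ev1 !mul1r.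
  - by rewrite mulrDl (scalar_D phi_lin) IHf IHf' (scalar_D (@ev_lin lam)) mulrDl.
  - by rewrite -scalerAl (scalar_Z phi_lin) IHf (scalar_Z (@ev_lin lam)) mulrA.
  - rewrite evzM -[lam j * _ * _]mulrA -IHf -(scalar_Z phi_lin); apply/eqP.
    rewrite -subr_eq0 -(scalar_B phi_lin) -(Hg j f); apply/eqP; congr phi.
    rewrite !mulrBl mulr_algl -scalerAl [g * h * f]mulrC; congr (_ - _); ring.
have phi0 : phi (g * h) != 0.
  apply/eqP => phi0; apply: NIg => f.
  by rewrite mulrC phiE phi0 mulr0.
have ev_l2 : in_l2 (fun n => ev lam (zk n.+1)).
  have := in_l2Z (phi (g * h))^-1 (in_l2_multiple (g * h)).
  by under eq_fun do rewrite phiE mulrC mulfK //.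
have evz j : ev lam (z j) = lam j by rewrite -[z j]mulr1 evzM ev1 mulr1.
have lam_l2 : in_l2 lam.
  by have := in_l2_primes ev_l2; under eq_fun do rewrite evz.
split; last first.
  move=> g'.
  have -> : (fun j => phi ((z j - (lam j)%:A) * (g' * h))) =
      (fun j => phi (z j * (g' * h)) + (- phi (g' * h)) * lam j).
    apply/funext => j; rewrite mulrBl mulr_algl (scalar_B phi_lin) (scalar_Z phi_lin).
    by rewrite mulNr [lam j * _]mulrC.
  apply: in_l2D (in_l2Z _ lam_l2).
  exact: (in_l2_primes (F := fun f => phi (f * (g' * h)))) (in_l2_multiple _).
(* If [|lam j| >= 1] then the terms at the powers of the j-th prime are not small. *)
split=> // j; rewrite normC_normc -[1]/(1%:C%C) ltcR ltNge; apply/negP => lam_ge1.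
have [N' HN'] := in_l2_small ev_l2 ltr01.
have [p p_pr pj] := prime_index_surj j.
have pN : (N' < p ^ N')%N by rewrite ltn_expl // prime_gt1.
have := HN' (p ^ N').-1; rewrite -ltnS prednK ?expn_gt0 ?prime_gt0 // => /(_ pN).
apply/negP; rewrite -leNgt.
have -> : ev lam (zk (p ^ N')) = lam j ^+ N'.
  elim: N' {HN' pN} => [|n IHn]; first by rewrite expn0 zk1 ev1 expr0.
  by rewrite expnS zkM ?expn_gt0 ?prime_gt0 // zk_prime // pj evzM IHn exprS.
elim: N' {HN' pN} => [|n IHn]; first by rewrite expr0 Normc.normc1.
by rewrite exprS Normc.normcM -[1]mulr1; apply: ler_pM.
Qed.

End BoundedColumns.

(** A majorant of the generating series of Phi on the monomials. *)
Definition dominated Phi (B : R) (mu : nat -> R) : Prop :=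
  forall js : seq nat, normc (Phi (\prod_(j <- js) z j)) <= B * \prod_(j <- js) mu j.

Lemma ev_prod lam js : ev lam (\prod_(j <- js) z j) = \prod_(j <- js) lam j.
Proof.
elim: js => [|j js IH]; first by rewrite !big_nil ev1.
by rewrite !big_cons evzM IH.
Qed.

Lemma normc_prod lam js :
  normc (\prod_(j <- js) lam j) = \prod_(j <- js) normc (lam j).
Proof.
elim: js => [|j js IH]; first by rewrite !big_nil Normc.normc1.
by rewrite !big_cons Normc.normcM IH.
Qed.

Lemma dominated_ev lam : dominated (ev lam) 1 (fun j => normc (lam j)).
Proof. by move=> js; rewrite ev_prod normc_prod mul1r. Qed.

(** A Cauchy estimate: for a monomial the derivative at mu in the direction [|c|]
    is at most the increment from mu to [mu + eps * |c|] divided by eps, because all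
    Taylor coefficients are non-negative. *)
Lemma dominated_D Phi B mu c eps : scalar Phi -> 0 <= B -> 0 < eps ->
    (forall j, 0 <= mu j) -> dominated Phi B mu ->
  dominated (fun f => Phi (D c f)) (B / eps) (fun j => mu j + eps * normc (c j)).
Proof.
move=> Phi_lin B_ge0 eps_gt0 mu_ge0 PhiB js.
pose nu j := mu j + eps * normc (c j).
have mu_nu ks : \prod_(j <- ks) mu j <= \prod_(j <- ks) nu j.
  apply: ler_prod => j _; rewrite mu_ge0 lerDl mulr_ge0 ?normc_ge0 // ltW //.
have prod_ge0 ks : 0 <= \prod_(j <- ks) mu j by apply: prodr_ge0.
(* The increment, not just its upper bound, makes the induction on [js] work. *)
suff H ks : normc (Phi (\prod_(j <- ks) z j * D c (\prod_(j <- js) z j))) <=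
    B / eps * (\prod_(j <- ks) mu j *
               (\prod_(j <- js) nu j - \prod_(j <- js) mu j)).
  have := H [::]; rewrite !big_nil !mul1r => /le_trans; apply.
  by rewrite ler_wpM2l ?divr_ge0 ?(ltW eps_gt0) // gerBl.
elim: js ks => [|j js IH] ks.
  by rewrite !big_nil D1 mulr0 (scalar_0 Phi_lin) Normc.normc0 subrr !mulr0.
rewrite !big_cons DzM mulrDr -scalerAr (scalar_D Phi_lin) (scalar_Z Phi_lin).
apply: le_trans (le_normcD _ _) _; rewrite Normc.normcM.
have H1 : normc (Phi (\prod_(j <- ks) z j * \prod_(j <- js) z j)) <=
    B * (\prod_(j <- ks) mu j * \prod_(j <- js) mu j).
  by have := PhiB (ks ++ js); rewrite !big_cat.
have := IH (rcons ks j); rewrite -!cats1 !big_cat !big_seq1 /= -mulrA => H2.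
apply: le_trans (lerD (ler_wpM2l (normc_ge0 _) H1) H2) _.
rewrite {1}/nu.
move: (mu_nu js) (prod_ge0 ks) (normc_ge0 (c j)) (mu_ge0 j).
move: (\prod_(j <- ks) mu j) (\prod_(j <- js) nu j) (\prod_(j <- js) mu j).
move=> P V M MV P0 b0 m0.
have -> : B / eps * (P * ((mu j + eps * normc (c j)) * V - mu j * M)) =
   B / eps * (P * mu j * (V - M)) + normc (c j) * (B * (P * V)).
  by field; apply: lt0r_neq0.
rewrite addrC lerD2l; apply: ler_wpM2l => //; apply: ler_wpM2l => //.
exact: ler_wpM2l.
Qed.

Lemma zk_prod n : (0 < n)%N -> exists js, zk n = \prod_(j <- js) z j.
Proof.
have [k] := ubnP n; elim: k n => // k IHk n nk n_gt0.
have [n1|n_neq1] := eqVneq n 1%N; first by exists [::]; rewrite n1 zk1 big_nil.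
have n_gt1 : (1 < n)%N by rewrite ltn_neqAle eq_sym n_neq1.
have p_pr := pdiv_prime n_gt1; have np := divnK (pdiv_dvd n).
have q_gt0 : (0 < n %/ pdiv n)%N by rewrite divn_gt0 ?pdiv_leq // prime_gt0.
have [|js Hjs] := IHk (n %/ pdiv n)%N _ q_gt0.
  by rewrite -ltnS; apply: leq_trans nk; rewrite ltnS ltn_Pdiv // prime_gt1.
exists (prime_index (pdiv n) :: js).
by rewrite big_cons -Hjs -zk_prime // mulrC -zkM ?np // prime_gt0.
Qed.

(** The function [n |-> |mu^kappa(n)|^2] is completely multiplicative, and the sum
    of its values at the primes is the squared norm of mu. *)
Lemma dominated_in_l2 Phi B mu r : 0 <= B -> dominated Phi B mu ->
    (forall j, 0 <= mu j <= r) -> r < 1 -> in_l2 (fun j => (mu j)%:C%C) ->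
  in_l2 (fun n => Phi (zk n.+1)).
Proof.
move=> B_ge0 PhiB mu_r r1 /in_l2P[S HS].
have mu_ge0 j : 0 <= mu j by case/andP: (mu_r j).
have r_ge0 : 0 <= r by case/andP: (mu_r 0%N) => /le_trans; apply.
pose a n := normc (ev (fun j => (mu j)%:C%C) (zk n)) ^+ 2.
have a_prime p : prime p -> a p = mu (prime_index p) ^+ 2.
  move=> p_pr; rewrite /a zk_prime // -[z _]mulr1 evzM ev1 mulr1 normc_real //.
have a1 : a 1%N = 1 by rewrite /a zk1 ev1 Normc.normc1 expr1n.
have aM m n : (0 < m)%N -> (0 < n)%N -> a (m * n)%N = a m * a n.
  by move=> m0 n0; rewrite /a zkM // ev_M Normc.normcM exprMn.
have a_ge0 n : 0 <= a n by apply: sqr_ge0.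
have a_r p : prime p -> a p <= r.
  move=> p_pr; rewrite a_prime //; have /andP[m0 mr] := mu_r (prime_index p).
  by rewrite expr2; apply: (le_trans _ mr); rewrite ler_piMl // (le_trans mr) // ltW.
have aS k : \sum_(p < k | prime p) a p <= S.
  rewrite (eq_bigr (fun p : 'I_k => mu (prime_index p) ^+ 2)) => [|p /a_prime //].
  rewrite (sum_prime_index (fun j => mu j ^+ 2)); apply: le_trans (HS (prime_index k)).
  by apply: ler_sum => j _; rewrite normc_real.
have bound := multiplicative_sum_le a1 aM a_ge0 r1 a_r aS.
apply/in_l2P; exists (B ^+ 2 * expR ((1 - r)^-1 * S)) => N.
apply: (@le_trans _ _ (\sum_(n < N) B ^+ 2 * a n.+1)); last first.
  by rewrite -mulr_sumr ler_wpM2l ?sqr_ge0.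
apply: ler_sum => n _; rewrite /a -exprMn.
rewrite ler_pXn2r ?nnegrE ?mulr_ge0 ?normc_ge0 //.
have [//|js ->] := @zk_prod n.+1; apply: le_trans (PhiB js) _.
rewrite ev_prod normc_prod ler_wpM2l //.
by under [leRHS]eq_bigr do rewrite normc_real //.
Qed.

Lemma in_l2_bounded x : in_l2 x -> exists2 b, 0 < b & forall j, normc (x j) <= b.
Proof.
move=> /in_l2P[S HS]; exists (S + 1) => [|j].
  by have := HS 0%N; rewrite big_ord0; lra.
have := HS j.+1; rewrite big_ord_recr /=.
have : 0 <= \sum_(i < j) normc (x i) ^+ 2 by apply: sumr_ge0 => i _; apply: sqr_ge0.
have := sqr_ge0 (normc (x j) - 1); have := normc_ge0 (x j); nra.
Qed.

Lemma in_l2_normc x : in_l2 x -> in_l2 (fun j => (normc (x j))%:C%C : C).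
Proof.
move=> /in_l2P[S HS]; apply/in_l2P; exists S => N; apply: le_trans (HS N).
apply: ler_sum => j _; by rewrite normc_real ?normc_ge0.
Qed.

(** Each derivative enlarges mu by [eps * |c|]; eps is chosen so small that the new
    sequence stays at distance [(1 - r) / 2] from 1. A square summable sequence in
    the polydisc is bounded by some [r < 1] because its tail is small. *)
Lemma jet_dominated lam Phi : jet D ev (@in_l2 R) lam Phi ->
    in_polydisc lam -> in_l2 lam ->
  exists B (mu : nat -> R) r, [/\ 0 <= B /\ dominated Phi B mu,
    forall j, 0 <= mu j <= r, r < 1 & in_l2 (fun j => (mu j)%:C%C)].
Proof.
move=> jPhi lam_disc lam_l2; elim: jPhi => [|c Psi c_l2 jPsi].
  have half_gt0 : 0 < 2^-1 :> R by rewrite invr_gt0.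
  have [N HN] := in_l2_small lam_l2 half_gt0.
  pose r := \big[Num.max/2^-1]_(j < N) normc (lam j).
  exists 1, (fun j => normc (lam j)), r; split.
  - by split; [apply: ler01|apply: dominated_ev].
  - move=> j; rewrite normc_ge0 /=; have [jN|Nj] := ltnP j N.
      exact: (le_bigmax _ (fun j : 'I_N => normc (lam j)) (Ordinal jN)).
    apply: le_trans (ltW (HN _ Nj)) _; exact: bigmax_ge_id.
  - apply/bigmax_ltP; split=> [|j _]; first by lra.
    by have := lam_disc j; rewrite normC_normc -[1]/(1%:C%C) ltcR.
  - exact: in_l2_normc.
move=> [B [mu [r [[B_ge0 PsiB] mu_r r1 mu_l2]]]].
have [b b_gt0 cb] := in_l2_bounded c_l2.
pose eps := (1 - r) / (2 * b).
have eps_gt0 : 0 < eps by rewrite divr_gt0 //; lra.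
have mu_ge0 j : 0 <= mu j by case/andP: (mu_r j).
exists (B / eps), (fun j => mu j + eps * normc (c j)), (r + (1 - r) / 2); split.
- split; first by rewrite divr_ge0 // ltW.
  by apply: dominated_D => //; apply: jet_scalar jPsi.
- move=> j; have /andP[m0 mr] := mu_r j.
  apply/andP; split.
    by rewrite addr_ge0 // mulr_ge0 ?normc_ge0 // ltW.
  apply: lerD => //.
  apply: (@le_trans _ _ (eps * b)); first by rewrite ler_pM2l.
  by rewrite /eps invfM mulrA mulfVK // gt_eqF.
- lra.
- have := in_l2D mu_l2 (in_l2Z eps%:C%C (in_l2_normc c_l2)).
  congr in_l2; apply/funext => j.
  by rewrite (rmorphD _ (mu j)) (rmorphM _ eps).
Qed.

Lemma sum_of_products_hilbert_schmidt (T : A -> A -> C) :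
    sum_of_products (fun Psi => exists2 lam, in_polydisc lam /\ in_l2 lam &
                 jet D ev (@in_l2 R) lam Psi) T ->
  hilbert_schmidt (fun n m => T (zk n.+1) (zk m.+1)).
Proof.
have l2 Psi : (exists2 lam, in_polydisc lam /\ in_l2 lam &
    jet D ev (@in_l2 R) lam Psi) -> in_l2 (fun n => Psi (zk n.+1)).
  move=> [lam [lam_disc lam_l2] jPsi].
  have [B [mu [r [[B_ge0 PsiB] mu_r r1 mu_l2]]]] := jet_dominated jPsi lam_disc lam_l2.
  exact: dominated_in_l2 PsiB mu_r r1 mu_l2.
elim=> [|a Phi Psi T' QPhi QPsi _ IH]; first exact: hilbert_schmidt0.
apply: hilbert_schmidtD => //.
have -> : (fun n m => a * (Phi (zk n.+1) * Psi (zk m.+1))) =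
    (fun n m => (a * Phi (zk n.+1)) * Psi (zk m.+1)).
  by do 2 apply/funext => ?; rewrite mulrA.
apply: (hilbert_schmidt_tensor (x := fun n => a * Phi (zk n.+1))
                               (y := fun m => Psi (zk m.+1))).
  by apply: in_l2Z; apply: l2.
exact: l2.
Qed.

End HelsonSequences.

(** * Jets and factorizable operators *)

Section HelsonForms.
Variable R : realType.
Local Notation C := R[i].
Local Notation P := (cpoly R).
Implicit Types (f g : P) (c lam : nat -> C) (Phi : P -> C) (cs : seq (nat -> C)).

Lemma zkappa1 : zkappa R 1 = 1.
Proof. by rewrite zkappaE kappa1 monom1. Qed.

Lemma zkappaM m n : (0 < m)%N -> (0 < n)%N ->
  zkappa R (m * n) = zkappa R m * zkappa R n.
Proof. by move=> m0 n0; rewrite !zkappaE kappaM // monomM. Qed.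

Lemma zkappa_prime p : prime p -> zkappa R p = zvar R (prime_index p).
Proof. by move=> p_pr; rewrite zkappaE zvarE kappa_prime. Qed.

Section Operators.
Variable X : (nat -> C) -> Prop.

Let jet := jet (@dirderiv R) (@peval R) X.

Definition coefficients_in (E : factorizable R) : Prop :=
  match E with FConst _ => True | FDiff M c _ => forall m, X (c m) end.

Let iter_dirderiv cs f := foldr (@dirderiv R) f cs.

Lemma jet_iter_dirderiv lam cs : (forall c, c \in cs -> X c) ->
  jet lam (fun f => peval lam (iter_dirderiv cs f)).
Proof.
have : jet lam (peval lam) by apply: jet_ev.
move: (peval lam) => Phi; elim: cs Phi => [|c cs IH] Phi jPhi Xcs /=; first exact: jPhi.
apply: (IH (fun f => Phi (dirderiv c f))) => [|d dcs].
  by apply: jet_D => //; apply: Xcs; rewrite mem_head.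
by apply: Xcs; rewrite inE dcs orbT.
Qed.

Lemma jetP lam Phi : jet lam Phi -> exists2 cs, forall c, c \in cs -> X c &
  Phi = fun f => peval lam (iter_dirderiv cs f).
Proof.
elim=> [|c Psi Xc _ [cs Xcs ->]]; first by exists [::].
exists (rcons cs c) => [d|]; last first.
  by apply/funext => f; rewrite /iter_dirderiv foldr_rcons.
by rewrite mem_rcons inE => /orP[/eqP ->|/Xcs].
Qed.

Lemma dirderiv_cst0 c : (forall j, c j = 0) -> dirderiv c = fun=> 0.
Proof.
move=> c0; apply/funext => f.
have -> : c = (fun j => 0 * c j) by apply/funext => j; rewrite c0 mulr0.
by rewrite dirderivZ scale0r.
Qed.

Lemma iter_dirderiv_cst0 cs c : c \in cs -> (forall j, c j = 0) ->
  iter_dirderiv cs = fun=> 0.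
Proof.
move=> + c0; elim: cs => // d cs IH; rewrite inE => /orP[/eqP <-|/IH E].
  by apply/funext => f /=; rewrite dirderiv_cst0.
apply/funext => f; rewrite /iter_dirderiv /= -/(iter_dirderiv cs f) E.
exact: (linear_0 (dirderiv_is_linear d)).
Qed.

Lemma iter_dirderivE M (c : 'I_M -> nat -> C) f :
  foldr (fun m h => dirderiv (c m) h) f (enum 'I_M) =
  iter_dirderiv [seq c m | m <- enum 'I_M] f.
Proof. by rewrite /iter_dirderiv foldr_map. Qed.

Hypothesis XZ : forall a c, X c -> X (fun j => a * c j).

(** Factorizable operators of positive order carry no scalar and only non-zero
    sequences: a vanishing multiple is dropped, and otherwise the scalar is absorbed
    into the first sequence. *)
Lemma factorizable_of_jet a lam Phi : jet lam Phi ->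
  (forall f, a * Phi f = 0) \/
  exists2 E : factorizable R, coefficients_in E &
    forall f, a * Phi f = peval lam (fapply E f).
Proof.
move=> /jetP[cs Xcs ->].
have [->|a0] := eqVneq a 0; first by left=> f; rewrite mul0r.
have [[c ccs c0]|/forall2NP Hcs] := pselect (exists2 c, c \in cs & forall j, c j = 0).
  left=> f; rewrite (iter_dirderiv_cst0 ccs c0).
  by rewrite (scalar_0 (peval_is_scalar lam)) mulr0.
right; case: cs Xcs Hcs => [|c cs] Xcs Hcs.
  by exists (FConst a) => // f /=; rewrite pevalZ.
pose ds := (fun j => a * c j) :: cs.
pose d (m : 'I_(size cs).+1) := nth (fun=> 0) ds m.
have dE : [seq d m | m <- enum 'I_(size cs).+1] = ds.
  rewrite /d (map_comp (nth _ ds) val) val_enum_ord.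
  by rewrite -[RHS](mkseq_nth (fun=> 0)).
have d0 m : exists j, d m j != 0.
  apply: contrapT => /forallNP dm0.
  have {}dm0 j : d m j = 0 by apply/eqP; rewrite -[_ == _]negbK; apply/negP.
  have : d m \in ds by apply: mem_nth.
  rewrite inE => /orP[/eqP dmE|dmcs].
    have [] := Hcs c; rewrite ?mem_head //; apply=> j.
    by have := dm0 j; rewrite dmE => /eqP; rewrite mulf_eq0 (negPf a0) => /eqP.
  by have [] := Hcs (d m); rewrite ?inE ?dmcs ?orbT.
exists (FDiff d0) => [m|f] /=.
  have : d m \in ds by apply: mem_nth.
  rewrite inE => /orP[/eqP ->|dmcs]; first by apply/XZ/Xcs/mem_head.
  by apply: Xcs; rewrite inE dmcs orbT.
by rewrite iter_dirderivE dE /iter_dirderiv /= dirderivZ pevalZ.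
Qed.

Variable Y : (nat -> C) -> Prop.

Lemma jets_represented Phi : jets (@dirderiv R) (@peval R) Y X Phi ->
  exists L (E : 'I_L -> factorizable R) (lam : 'I_L -> nat -> C),
    (forall f, Phi f = \sum_(l < L) peval (lam l) (fapply (E l) f)) /\
    forall l, Y (lam l) /\ coefficients_in (E l).
Proof.
elim=> [|a lam Psi Th Yl jPsi _ [L [E [mu [ThE YX]]]]].
  exists 0%N, (fun=> FConst 0), (fun=> fun=> 0); split=> [f|[]//].
  by rewrite big_ord0.
have [aPsi0|[E0 XE0 aPsiE]] := factorizable_of_jet a jPsi.
  by exists L, E, mu; split=> // f; rewrite aPsi0 add0r.
exists L.+1, (fun l => oapp E E0 (unlift ord0 l)), (fun l => oapp mu lam (unlift ord0 l)).
split=> [f|l]; last by case: unliftP => [j|] _ /=; [apply: YX|split].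
rewrite big_ord_recl unlift_none /= aPsiE ThE; congr (_ + _).
by apply: eq_bigr => l _; rewrite liftK.
Qed.

Lemma represented_jets L (E : 'I_L -> factorizable R) (lam : 'I_L -> nat -> C) :
    (forall l, Y (lam l) /\ coefficients_in (E l)) ->
  jets (@dirderiv R) (@peval R) Y X
    (fun f => \sum_(l < L) peval (lam l) (fapply (E l) f)).
Proof.
move=> YX; apply: jets_sum => l; have [Yl] := YX l.
case: (E l) => [a _|M c c0 Xc] /=.
  under eq_fun do rewrite pevalZ.
  exact/jetsZ/(jets_jet Yl)/jet_ev.
under eq_fun do rewrite iter_dirderivE.
apply: (jets_jet Yl); apply: jet_iter_dirderiv => d /mapP[m _ ->].
exact: Xc.
Qed.

End Operators.
End HelsonForms.

Theorem theorem6p6 (R : realType) (B : {biscalar (cpoly R)})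
    (hB : Helson_form B) :
  (finite_rank B <->
     exists (L : nat) (D : 'I_L -> factorizable R) (lam : 'I_L -> nat -> R[i]),
       represents B D lam)
  /\
  (bounded_form B /\ finite_rank B <->
     exists (L : nat) (D : 'I_L -> factorizable R) (lam : 'I_L -> nat -> R[i]),
       represents B D lam /\
       forall l : 'I_L,
         in_polydisc (lam l) /\ in_l2 (lam l) /\ fin_l2 (D l)).
Proof.
pose phi f := B f 1.
have phi_lin : scalar phi by move=> a f g; rewrite /phi linearPl.
have BE f g : B f g = phi (f * g) by apply: hB.
have radE f : form_kernel B f <-> radical phi f.
  by split=> H g; [rewrite -BE|rewrite BE]; apply: H.
have rankE : finite_rank B <-> exists d, codim_le d (radical phi).
  by split=> -[d [e eI]]; exists d, e => v; have [a /radE Ia] := eI v; exists a.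
have zgen := @zvar_generates R.
pose represented_by Y X := jets_of_finite_codim zgen (@dirderiv_is_linear R)
  (@dirderiv1 R) (@dirderiv_zvarM R) (@peval_is_scalar R) (@peval1 R)
  (@peval_zvarM R) (Y := Y) (X := X) phi_lin.
have rank_of_jets Y X (Phi : cpoly R -> R[i]) :
    jets (@dirderiv R) (@peval R) Y X Phi -> (forall f, phi f = Phi f) -> finite_rank B.
  move=> /(jets_sum_of_products zgen (@dirderiv_is_linear R) (@dirderiv1 R)
    (@dirderiv_zvarM R) (@peval_is_scalar R) (@peval1 R) (@peval_zvarM R)) sPhi phiE.
  apply/rankE.
  have [|d codI] := sum_of_products_codim _ sPhi.
    move=> Psi [lam _ jPsi].
    exact: (jet_scalar (@dirderiv_is_linear R) (@peval_is_scalar R) jPsi).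
  by exists d; apply: codim_leS codI => f H g; rewrite phiE H.
have phiE L (D : 'I_L -> factorizable R) lam : represents B D lam ->
    forall f, phi f = \sum_(l < L) peval (lam l) (fapply (D l) f).
  by move=> BD f; rewrite /phi BD mulr1.
split; split.
- move=> /rankE[d codI].
  have jphi : jets (@dirderiv R) (@peval R) (fun=> True) (fun=> True) phi.
    by apply: represented_by codI _.
  have [//|L [D [lam [DE _]]]] := jets_represented _ jphi.
  by exists L, D, lam => f g; rewrite BE DE.
- move=> [L [D [lam /phiE DE]]].
  apply: rank_of_jets DE; apply: (represented_jets (X := fun=> True) (Y := fun=> True)).
  by move=> l; split=> //; case: (D l).
- move=> [bB /rankE[d codI]].
  have col m : (0 < m)%N -> in_l2 (fun n => phi (zkappa R (n.+1 * m))).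
    by case: m => // m _; apply: (bounded_column m bB).
  have pt := point_of_radical zgen (@peval_is_scalar R) (@peval1 R) (@peval_zvarM R)
    (@zkappa1 R) (@zkappaM R) (@zkappa_prime R) phi_lin col.
  have /(jets_represented (@in_l2Z R)) := represented_by _ _ _ codI pt.
  move=> [L [D [lam [DE YX]]]]; exists L, D, lam; split=> [f g|l].
    by rewrite BE DE.
  by have [[lam_disc lam_l2] Dl2] := YX l.
- move=> [L [D [lam [/phiE DE YX]]]].
  have jPhi : jets (@dirderiv R) (@peval R)
      (fun lam => in_polydisc lam /\ in_l2 lam) (@in_l2 R)
      (fun f => \sum_(l < L) peval (lam l) (fapply (D l) f)).
    apply: represented_jets => l; have [lam_disc [lam_l2 Dl2]] := YX l.
    by split=> //; split.
  split; last exact: rank_of_jets jPhi DE.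
  apply: hilbert_schmidt_bounded.
  have := sum_of_products_hilbert_schmidt zgen (@dirderiv_is_linear R)
    (@dirderiv1 R) (@dirderiv_zvarM R) (@peval_is_scalar R) (@peval1 R)
    (@peval_zvarM R) (@zkappa1 R) (@zkappaM R) (@zkappa_prime R)
    (jets_sum_of_products zgen (@dirderiv_is_linear R) (@dirderiv1 R)
    (@dirderiv_zvarM R) (@peval_is_scalar R) (@peval1 R) (@peval_zvarM R) jPhi).
  congr hilbert_schmidt; do 2 apply/funext => ?.
  by rewrite -DE -zkappaM.
Qed.
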